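(* Let $G\subset \mathrm{GL}(V)$ be a complex reflection group and $N\trianglelefteq G$ a normal reflection subgroup. Let $M$ be a $G$-module and let $U_M^N$ be the $G$-module dual to $(\mathcal{C}_N\otimes M^* )^N$. Then: (i) If $M$ is amenable as a $G$-module, then $U_M^N$ is amenable. (ii) If $M$ is amenable as an $N$-module and $U_M^N$ is amenable, then $M$ is amenable as a $G$-module.
   Context: Reflection groups. A reflection on a finite-dimensional complex vector space $V$ is an element of $\mathrm{GL}(V)$ of finite order fixing some hyperplane pointwise. A complex reflection group $G\subset\mathrm{GL}(V)$ is a finite subgroup generated by reflections; a normal reflection subgroup $N\trianglelefteq G$ is a normal subgroup generated by reflections. $S(V^* )$ is the algebra of polynomial functions on $V$, graded by degree. A $G$-module is a finite-dimensional complex representation of $G$. Harmonic polynomials and exponents. $\mathcal{C}_G\subset S(V^* )$ is the space of $G$-harmonic polynomials (those annihilated by all $G$-invariant constant-coefficient polynomial differential operators with no constant term); it is a graded $G$-stable complement to the ideal generated by homogeneous $G$-invariants of positive degree. $\mathcal{C}_N\subset S(V^* )$ is defined likewise for $N$, and is $G$-stable. For a $G$-module $M$ of dimension $m$, the $M$-exponents $e_1^G(M),\dots,e_m^G(M)$ of $G$ are the degrees (as a multiset) of a homogeneous basis of the $m$-dimensional space $(\mathcal{C}_G\otimes M^* )^G$, graded via $\mathcal{C}_G$; the exponents $e_i^N(M)$ of $N$ are defined in the same way. Amenability. A $G$-module $M$ of dimension $m$ is amenable if $\sum_{i=1}^m e_i^G(M)=e_1^G(\bigwedge^m M)$; amenability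 as an $N$-module is defined in the same way with $N$ in place of $G$. ''$U_M^N$ is amenable'' means that it is amenable as a $G$-module; equivalently, it is amenable as a module over the reflection group $H=G/N$ acting on $V/N$. *)

(* Defs.v *)
From HB Require Import structures.
From mathcomp Require Import all_boot all_order all_algebra all_fingroup.
From mathcomp Require Import mxrepresentation.
From mathcomp Require Import reals complex.
From mathcomp Require Import mpoly.

Set Implicit Arguments.
Unset Strict Implicit.
Unset Printing Implicit Defensive.

Import GRing.Theory.
Local Open Scope ring_scope.

(* Conventions.  A finite-dimensional G-module of dimension m is a matrix
   representation [rM : mx_representation C G m], read as the LEFT action
   u |-> rM g *m u of G on the space 'cV[C]_m of column vectors.  A finite
   subgroup of GL(V), with V = 'cV[C]_n, is the image of a faithful
   representation rV of a finite group.  S(V^* ) is {mpoly C[n]}, 'X_i being the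
   i-th coordinate function on V. *)

Section Modules.
Variables (C : fieldType) (gT : finGroupType) (G : {group gT}) (m : nat).
Variable rM : mx_representation C G m.

(* M^*, in the basis dual to the standard basis of M. *)
Definition dual_mx (g : gT) : 'M[C]_m := (rM g^-1%g)^T.

Fact dual_mx_repr : mx_repr G dual_mx.
Proof.
split=> [|g h Gg Gh]; first by rewrite /dual_mx invg1 repr_mx1 trmx1.
by rewrite /dual_mx invMg repr_mxM ?groupV // trmx_mul.
Qed.

Definition dual_repr : mx_representation C G m := MxRepresentation dual_mx_repr.

(* The top exterior power of M, in the basis x_1 /\ ... /\ x_m:
   g x_1 /\ ... /\ g x_m = \det (rM g) x_1 /\ ... /\ x_m. *)
Definition topext_mx (g : gT) : 'M[C]_1 := (\det (rM g))%:M.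

Fact topext_mx_repr : mx_repr G topext_mx.
Proof.
split=> [|g h Gg Gh]; first by rewrite /topext_mx repr_mx1 det1.
by rewrite /topext_mx repr_mxM // det_mulmx scalar_mxM.
Qed.

Definition topext_repr : mx_representation C G 1 :=
  MxRepresentation topext_mx_repr.

End Modules.

Section ReflectionGroups.
Variables (C : fieldType) (gT : finGroupType) (G : {group gT}) (n : nat).
Variable rV : mx_representation C G n.

(* g fixes pointwise a hyperplane, the kernel of a nonzero linear form a; its
   order is finite since gT is. *)
Definition is_reflection (g : gT) : Prop :=
  exists a : 'rV[C]_n, a != 0 /\
    forall v : 'cV[C]_n, a *m v = 0 -> rV g *m v = v.

Definition generated_by_reflections : Prop :=
  exists S : {set gT},
    (forall s, s \in S -> is_reflection s) /\ <<S>>%g = G :> {set gT}.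

Definition complex_reflection_group : Prop :=
  mx_faithful rV /\ generated_by_reflections.

End ReflectionGroups.

Section LinearAlgebra.
Variables (C : fieldType) (L : lmodType C).

Definition is_basis (W : L -> Prop) (k : nat) (b : 'I_k -> L) : Prop :=
  [/\ forall i, W (b i),
      forall c : 'I_k -> C, \sum_i c i *: b i = 0 -> forall i, c i = 0
    & forall w, W w -> exists c : 'I_k -> C, w = \sum_i c i *: b i].

(* rW is the matrix of the action of G on the G-stable subspace W of L, in some
   basis of W. *)
Definition affords (gT : finGroupType) (G : {group gT}) (act : gT -> L -> L)
    (W : L -> Prop) (k : nat) (rW : mx_representation C G k) : Prop :=
  exists b : 'I_k -> L, is_basis W b /\
    forall g, g \in G -> forall j, act g (b j) = \sum_i rW g i j *: b i.

End LinearAlgebra.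

Section Harmonic.
Variables (C : fieldType) (gT : finGroupType) (G : {group gT}) (n : nat).

(* (g f)(v) = f (g^-1 v) *)
Definition poly_act (rV : mx_representation C G n) (g : gT)
    (f : {mpoly C[n]}) : {mpoly C[n]} :=
  f \mPo [tuple \sum_j rV g^-1%g i j *: 'X_j | i < n].

Variable rV : mx_representation C G n.

(* The constant-coefficient differential operator with symbol D: 'X_i stands for
   the partial derivative along the i-th standard basis vector of V. *)
Definition diffop (D f : {mpoly C[n]}) : {mpoly C[n]} :=
  \sum_(a <- msupp D) D@_a *: f^`M[a].

(* Constant-coefficient operators form S(V), the algebra of polynomial functions
   on V^*; hence the action of G on symbols through dual_repr. *)
Definition invariant_diffop (D : {mpoly C[n]}) : Prop :=
  forall g, g \in G -> poly_act (dual_repr rV) g D = D.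

Definition harmonic (f : {mpoly C[n]}) : Prop :=
  forall D, invariant_diffop D -> D@_0%MM = 0 -> diffop D f = 0.

End Harmonic.

Section Exponents.
Variables (C : fieldType) (gT : finGroupType) (G : {group gT}) (n : nat).
Variable rV : mx_representation C G n.

(* For a module L with standard basis x_1, ..., x_m, the family F stands for the
   element \sum_i F i (x) x_i of S(V^* ) (x) L, with the diagonal action. *)
Definition tensor_act (m : nat) (rL : mx_representation C G m) (g : gT)
    (F : {ffun 'I_m -> {mpoly C[n]}}) : {ffun 'I_m -> {mpoly C[n]}} :=
  [ffun j => \sum_i rL g j i *: poly_act rV g (F i)].

(* (C_G (x) L)^G *)
Definition harmonic_invariant (m : nat) (rL : mx_representation C G m)
    (F : {ffun 'I_m -> {mpoly C[n]}}) : Prop :=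
  (forall i, harmonic rV (F i)) /\
  (forall g, g \in G -> tensor_act rL g F = F).

(* The e i are the degrees of a homogeneous basis of (C_G (x) M^* )^G; that this
   space has dimension m = dim M is part of the predicate. *)
Definition exponents (m : nat) (rM : mx_representation C G m)
    (e : 'I_m -> nat) : Prop :=
  exists b : 'I_m -> {ffun 'I_m -> {mpoly C[n]}},
    is_basis (harmonic_invariant (dual_repr rM)) b /\
    forall i j, b i j \is (e i).-homog.

Definition amenable (m : nat) (rM : mx_representation C G m) : Prop :=
  exists (e : 'I_m -> nat) (d : 'I_1 -> nat),
    [/\ exponents rM e, exponents (topext_repr rM) d
      & (\sum_i e i)%N = d ord0].

End Exponents.

Section NormalSubgroup.
Variables (C : fieldType) (gT : finGroupType) (G N : {group gT}) (n : nat).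
Variables (rV : mx_representation C G n) (sNG : N \subset G).

(* rU is the G-module U_M^N dual to (C_N (x) M^* )^N, in the dual of some basis
   of the latter. *)
Definition is_U (m : nat) (rM : mx_representation C G m) (k : nat)
    (rU : mx_representation C G k) : Prop :=
  exists rW : mx_representation C G k,
    affords (tensor_act rV (dual_repr rM))
      (harmonic_invariant (subg_repr rV sNG) (dual_repr (subg_repr rM sNG))) rW
    /\ forall g, g \in G -> rU g = dual_repr rW g.

End NormalSubgroup.

(* Main.v *)
Require Import Defs.
From HB Require Import structures.
From mathcomp Require Import all_boot all_order all_algebra all_fingroup.
From mathcomp Require Import mxrepresentation.
From mathcomp Require Import reals complex.
From mathcomp Require Import mpoly.
From mathcomp.multinomials Require Import ssrcomplements.
From Stdlib Require Import Classical.

Set Implicit Arguments.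
Unset Strict Implicit.
Unset Printing Implicit Defensive.

Import Order.TTheory GRing.Theory Num.Theory.
Local Open Scope ring_scope.

(** Write S for S(V^* ).  For a reflection group G and a G-module M of dimension
    m, the covariants (S (x) M^* )^G form a free S^G-module, with any basis of
    (C_G (x) M^* )^G as a basis, and there are m exponents.  The
    determinant of such a basis lies in (S (x) Lambda^m M^* )^G, which is S^G p
    for a single p; hence p divides it and M is amenable if and only if the
    determinant and p have the same degree.

    Let b be a basis of (C_N (x) M^* )^N and \det b its determinant.  Expanding a
    G-covariant of M on b has for coefficients a G-covariant of U, because the
    coefficients are unique; so if F is a basis of the G-covariants of U then
    F b is one for M, with determinant \det F \det b (msize_det_factor).  Let p
    and q generate the determinantal covariants of M and U.  As q \det b is a
    determinantal covariant of M, p divides it.  If M is amenable then the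
    degree of p is that of \det F \det b, so the degree of \det F is at most
    that of q, and U is amenable.  Conversely, if M is amenable for N then
    \det b divides p, with a determinantal covariant of U as quotient, which q
    divides; if U is amenable too, then the degree of p is at least that of
    \det F \det b, and M is amenable for G.

    The rest is the freeness statement.  Generation (harmonics_generate) follows
    from the decomposition of S as the sum of C_G and the ideal I of positive
    degree invariants: C_G is the orthogonal complement of I for a positive
    definite Hermitian form for which multiplication by a polynomial is adjoint
    to a differential operator (harmonic_orthogonal).  Linear independence over
    S^G of a family that is free modulo I (free_over_invariants) is where
    reflections enter, through Chevalley's divided differences (chevalley).
    Independence over S, hence a nonzero determinant, and the count of m elements
    come from Dedekind's independence of automorphisms (harmonic_free_domain,
    covariants_separate). *)

(** * Linear substitutions *)

(** The polynomial v |-> f (A *m v).  Rectangular A occur: the invariant Hermitian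
    form on S(V^* ) is pulled back from a space of larger dimension. *)
HB.lock Definition lsubst (C : fieldType) p q (A : 'M[C]_(p, q))
    (f : {mpoly C[p]}) : {mpoly C[q]} :=
  f \mPo [tuple \sum_j A i j *: 'X_j | i < p].
Canonical lsubst_unlockable := Unlockable lsubst.unlock.

Section LinearSubstitution.
Variable C : fieldType.

Fact lsubst_is_linear p q (A : 'M[C]_(p, q)) : linear (lsubst A).
Proof. by move=> c f g; rewrite unlock linearP. Qed.

Fact lsubst_is_monoid_morphism p q (A : 'M[C]_(p, q)) : monoid_morphism (lsubst A).
Proof. by split=> [|f g]; rewrite unlock ?rmorph1 ?rmorphM. Qed.

HB.instance Definition _ p q (A : 'M[C]_(p, q)) :=
  GRing.isLinear.Build C {mpoly C[p]} {mpoly C[q]} _ (lsubst A) (lsubst_is_linear A).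
HB.instance Definition _ p q (A : 'M[C]_(p, q)) :=
  GRing.isMonoidMorphism.Build {mpoly C[p]} {mpoly C[q]} (lsubst A)
    (lsubst_is_monoid_morphism A).

Lemma mpoly_gen_ind n (P : {mpoly C[n]} -> Prop) :
    (forall c, P c%:MP) -> (forall i, P 'X_i) ->
    (forall f g, P f -> P g -> P (f + g)) ->
    (forall f g, P f -> P g -> P (f * g)) ->
  forall f, P f.
Proof.
move=> PC PX PD PM; have P1: P 1 by rewrite -mpolyC1.
move=> f; elim/mpolyind: f => [|c m f nfm nzc Pf]; first by rewrite -mpolyC0.
apply: (PD) => //; rewrite -mul_mpolyC; apply: (PM) => //.
rewrite mpolyXE_id; apply: (big_ind P P1 PM) => i _.
by elim: (m i) => [|k IHk]; rewrite ?expr0 // exprS; apply: (PM).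
Qed.

Lemma lsubstX p q (A : 'M[C]_(p, q)) i : lsubst A 'X_i = \sum_j A i j *: 'X_j.
Proof. by rewrite unlock comp_mpolyXU -tnth_nth tnth_mktuple. Qed.

Lemma lsubstC p q (A : 'M[C]_(p, q)) c : lsubst A c%:MP = c%:MP.
Proof. by rewrite unlock comp_mpolyC. Qed.

Lemma lsubst_linform p q (A : 'M[C]_(p, q)) (a : 'I_p -> C) :
  lsubst A (\sum_i a i *: 'X_i) = \sum_j (\sum_i a i * A i j) *: 'X_j.
Proof.
rewrite linear_sum /=; under eq_bigr do rewrite linearZ /= lsubstX scaler_sumr.
rewrite exchange_big /=; apply: eq_bigr => j _.
by rewrite scaler_suml; apply: eq_bigr => i _; rewrite scalerA.
Qed.

Lemma lsubst_comp p q r (A : 'M[C]_(p, q)) (B : 'M[C]_(q, r)) f :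
  lsubst B (lsubst A f) = lsubst (A *m B) f.
Proof.
elim/mpoly_gen_ind: f => [c|i|f g IHf IHg|f g IHf IHg]; first by rewrite !lsubstC.
- rewrite !lsubstX lsubst_linform; apply: eq_bigr => k _.
  by rewrite mxE.
- by rewrite !rmorphD /= IHf IHg.
- by rewrite !rmorphM /= IHf IHg.
Qed.

Lemma lsubst1 p (f : {mpoly C[p]}) : lsubst 1%:M f = f.
Proof.
rewrite unlock -[RHS]comp_mpoly_id; congr comp_mpoly.
apply: eq_from_tnth => i; rewrite !tnth_mktuple (bigD1 i) //= big1 ?addr0.
  by rewrite mxE eqxx scale1r.
by move=> j ne_ji; rewrite mxE eq_sym (negPf ne_ji) scale0r.
Qed.

Lemma lsubst_const p q (A : 'M[C]_(p, q)) f : (lsubst A f)@_0%MM = f@_0%MM.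
Proof.
elim/mpoly_gen_ind: f => [c|i|f g IHf IHg|f g IHf IHg].
- by rewrite lsubstC !mcoeffC !eqxx.
- rewrite lsubstX linear_sum /= !mcoeffX mnm1_eq0 big1 // => j _.
  by rewrite mcoeffZ mcoeffX mnm1_eq0 mulr0.
- by rewrite rmorphD !mcoeffD IHf IHg.
- by rewrite rmorphM /= !(rmorphM (mcoeff 0%MM)) /= IHf IHg.
Qed.

Lemma lsubst_homog p q (A : 'M[C]_(p, q)) f d :
  f \is d.-homog -> lsubst A f \is d.-homog.
Proof.
move=> /dhomogP homf; rewrite unlock comp_mpolyE big_seq.
apply: rpred_sum => m fm; apply: rpredZ.
have <-: (\sum_i m i)%N = d by rewrite -mdegE; apply: homf.
pose K (h : {mpoly C[q]}) e := is_true (h \is e.-homog).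
apply: (big_rec2 K) => [|i h e _ homh]; first exact: dhomog1.
apply: dhomogM => //; rewrite tnth_mktuple -[X in X.-homog]mul1n.
apply: dhomogMn.
apply: rpred_sum => j _; apply: rpredZ; rewrite dhomogX; exact/eqP/mdeg1.
Qed.

Lemma pihomog_lsubst p q (A : 'M[C]_(p, q)) f d :
  pihomog mdeg d (lsubst A f) = lsubst A (pihomog mdeg d f).
Proof.
have [k lt_d le_f]: exists2 k, (d < k)%N & (msize f <= k)%N.
  by exists (maxn d.+1 (msize f)); rewrite ?leq_maxl ?leq_maxr.
have ->: lsubst A f = \sum_(i < k) lsubst A (pihomog mdeg i f).
  by rewrite -(linear_sum (lsubst A)) -pihomog_partitionE.
rewrite (linear_sum (pihomog mdeg d)) (bigD1 (Ordinal lt_d)) //=.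
have homA i: lsubst A (pihomog mdeg i f) \is i.-homog by apply/lsubst_homog/pihomogP.
rewrite (pihomog_dE (homA d)) big1 ?addr0 // => i ne_id.
apply: pihomog_ne0 (homA i).
by apply: contraNneq ne_id => Eid; apply/eqP/val_inj.
Qed.

Lemma msize_homog_le n (f : {mpoly C[n]}) d : f \is d.-homog -> (msize f <= d.+1)%N.
Proof.
move/dhomogP=> homf; rewrite msizeE; apply/bigmax_leqP_seq => m fm _.
by rewrite homf.
Qed.

Lemma msize_homog n (f : {mpoly C[n]}) d :
  f != 0 -> f \is d.-homog -> msize f = d.+1.
Proof.
by move=> nzf /dhomogP homf; rewrite -(mlead_deg nzf) homf // mlead_supp.
Qed.

Lemma msize_lsubst p q (A : 'M[C]_(p, q)) f : (msize (lsubst A f) <= msize f)%N.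
Proof.
rewrite {1}(pihomog_partitionE (leqnn (msize f))) (linear_sum (lsubst A)) /=.
apply: leq_trans (msize_sum _ _ _) _; apply/bigmax_leqP => i _.
apply: leq_trans (ltn_ord i).
by apply/msize_homog_le/lsubst_homog/pihomogP.
Qed.

Lemma mcoeff_pihomog n (f : {mpoly C[n]}) d m :
  (pihomog mdeg d f)@_m = if mdeg m == d then f@_m else 0.
Proof.
rewrite pihomogE raddf_sum big_mkcond /=.
transitivity (\sum_(x <- msupp f) if mdeg m == d then (f@_x *: 'X_[x])@_m else 0).
  apply: eq_bigr => x _; rewrite mcoeffZ mcoeffX.
  by have [->//|_] := eqVneq x m; rewrite mulr0 !if_same.
case: ifP => _; last by rewrite big1.
by rewrite [in RHS](mpolyE f) raddf_sum.
Qed.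

Lemma mderiv_lsubst p q (A : 'M[C]_(p, q)) f i :
  (lsubst A f)^`M(i) = lsubst A (\sum_j A j i *: f^`M(j)).
Proof.
elim/mpoly_gen_ind: f => [c|k|f g IHf IHg|f g IHf IHg].
- by rewrite lsubstC mderivC big1 ?raddf0 // => j _; rewrite mderivC scaler0.
- have dX n (a b : 'I_n): ('X_a : {mpoly C[n]})^`M(b) = (a == b)%:R%:MP.
    rewrite mderivX mnm1E; have [->|_] := eqVneq a b; last by rewrite scale0r.
    by rewrite scale1r -{1}[U_(b)%MM]add0m addmK mpolyX0 mpolyC1.
  rewrite lsubstX linear_sum /= (bigD1 i) //= linearZ /= dX eqxx big1.
    rewrite (bigD1 k) //= dX eqxx big1 ?addr0.
      by rewrite linearZ /= lsubstC.
    by move=> j /negPf; rewrite dX eq_sym => ->; rewrite scaler0.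
  by move=> j /negPf ne; rewrite linearZ /= dX ne scaler0.
- rewrite rmorphD /= mderivD IHf IHg -rmorphD /= -big_split /=; congr lsubst.
  by apply: eq_bigr => j _; rewrite mderivD scalerDr.
- rewrite rmorphM /= mderivM IHf IHg -!rmorphM -rmorphD /=; congr lsubst.
  rewrite mulr_suml mulr_sumr -big_split /=; apply: eq_bigr => j _.
  by rewrite mderivM scalerDr scalerAl scalerAr.
Qed.

End LinearSubstitution.

(** * Differential operators and the pairing of S(V) with S(V^* ) *)

Section DifferentialOperators.
Variables (C : fieldType) (n : nat).
Implicit Types D E f g : {mpoly C[n]}.

Lemma diffop_widen k D f : (msize D <= k)%N ->
  diffop D f = \sum_(a : 'X_{1..n < k}) D@_a *: f^`M[a].
Proof.
move=> leDk; pose I : subFinType _ := 'X_{1..n < k}.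
rewrite /diffop (big_mksub I) //=; first last.
- by move=> x /msize_mdeg_lt /leq_trans; apply.
- by rewrite msupp_uniq.
by rewrite big_rmcond //= => i; move/memN_msupp_eq0 ->; rewrite scale0r.
Qed.

Lemma diffop_linear_l f : linear (fun D => diffop D f).
Proof.
move=> c D E /=; set k := maxn (msize (c *: D + E)) (maxn (msize D) (msize E)).
rewrite (@diffop_widen k) ?leq_maxl // (@diffop_widen k D); last first.
  by rewrite !leq_max leqnn !orbT.
rewrite (@diffop_widen k E); last by rewrite !leq_max leqnn !orbT.
rewrite scaler_sumr -big_split /=; apply: eq_bigr => a _.
by rewrite mcoeffD mcoeffZ scalerDl scalerA.
Qed.

Lemma diffop_linear_r D : linear (diffop D).
Proof.
move=> c f g; rewrite /diffop scaler_sumr -big_split /=; apply: eq_bigr => a _.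
by rewrite linearP scalerDr !scalerA mulrC.
Qed.

Definition apply_diffop f D := diffop D f.
HB.instance Definition _ f :=
  GRing.isLinear.Build C {mpoly C[n]} {mpoly C[n]} _ (apply_diffop f)
    (diffop_linear_l f).
HB.instance Definition _ D :=
  GRing.isLinear.Build C {mpoly C[n]} {mpoly C[n]} _ (diffop D)
    (diffop_linear_r D).

Lemma diffopDl D E f : diffop (D + E) f = diffop D f + diffop E f.
Proof. exact: (raddfD (apply_diffop f)). Qed.

Lemma diffopZl c D f : diffop (c *: D) f = c *: diffop D f.
Proof. exact: (linearZZ (apply_diffop f)). Qed.

Lemma diffop_suml I (r : seq I) (P : pred I) (F : I -> {mpoly C[n]}) f :
  diffop (\sum_(i <- r | P i) F i) f = \sum_(i <- r | P i) diffop (F i) f.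
Proof. exact: (raddf_sum (apply_diffop f)). Qed.

Lemma diffop_monomial a f : diffop 'X_[a] f = f^`M[a].
Proof. by rewrite /diffop msuppX big_seq1 mcoeffX eqxx scale1r. Qed.

Lemma diffopC c f : diffop c%:MP f = c *: f.
Proof.
by rewrite -[c%:MP]mulr1 mul_mpolyC -mpolyX0 diffopZl diffop_monomial mderivm0m.
Qed.

Lemma diffopM D E f : diffop (D * E) f = diffop D (diffop E f).
Proof.
elim/mpoly_gen_ind: D E f => [c|i|D1 D2 IH1 IH2|D1 D2 IH1 IH2] E f.
- by rewrite mul_mpolyC diffopZl diffopC.
- rewrite diffop_monomial; elim/mpolyind: E => [|c m E _ _ IHE].
    by rewrite mulr0 -(scale0r 0) !diffopZl !scale0r raddf0.
  rewrite mulrDr !diffopDl IHE mderivmD -scalerAr -mpolyXD !diffopZl mderivmZ.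
  by rewrite !diffop_monomial addmC mderivmDm.
- by rewrite mulrDl !diffopDl IH1 IH2.
- by rewrite -mulrA IH1 IH2.
Qed.

(** Multiplication by a symbol is adjoint to its differential operator for this
    perfect pairing of S(V) with S(V^* ); distinct monomials are orthogonal. *)
Definition pairing D f := (diffop D f)@_0%MM.

Definition mfact (a : 'X_{1..n}) := (\prod_i (a i)`!)%N.

Lemma mfact_gt0 a : (0 < mfact a)%N.
Proof. by apply: prodn_gt0 => i; apply: fact_gt0. Qed.

Lemma mderivm_const a f : (f^`M[a])@_0%MM = f@_a * (mfact a)%:R.
Proof.
rewrite mcoeff_mderivm addm0 mulr_natr; congr (_ *+ _).
by apply: eq_bigr => i _; rewrite ffactnn.
Qed.

Lemma pairingE D f :
  pairing D f = \sum_(a <- msupp D) D@_a * f@_a * (mfact a)%:R.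
Proof.
rewrite /pairing /diffop raddf_sum /=; apply: eq_bigr => a _.
by rewrite mcoeffZ mderivm_const mulrA.
Qed.

Lemma pairing_widen k D f : (msize D <= k)%N ->
  pairing D f = \sum_(a : 'X_{1..n < k}) D@_a * f@_a * (mfact a)%:R.
Proof.
move=> le_Dk; rewrite /pairing (diffop_widen _ le_Dk) raddf_sum /=.
by apply: eq_bigr => a _; rewrite mcoeffZ mderivm_const mulrA.
Qed.

Lemma pairingM D E f : pairing (D * E) f = pairing D (diffop E f).
Proof. by rewrite /pairing diffopM. Qed.

Lemma pairing_pihomog d D f :
  pairing (pihomog mdeg d D) f = pairing D (pihomog mdeg d f).
Proof.
rewrite {1}/pairing pihomogE diffop_suml raddf_sum /= pairingE big_mkcond /=.
apply: eq_bigr => a _; rewrite mcoeff_pihomog; case: ifP => _; last first.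
  by rewrite mulr0 mul0r.
by rewrite diffopZl mcoeffZ diffop_monomial mderivm_const mulrA.
Qed.

End DifferentialOperators.

(** Differentiating f o A along v is differentiating f along A v, and on symbols
    v |-> A v is the substitution of A^T; the generators of S(V) suffice. *)
Lemma diffop_lsubst (C : fieldType) p q (A : 'M[C]_(p, q)) D f :
  diffop D (lsubst A f) = lsubst A (diffop (lsubst A^T D) f).
Proof.
elim/mpoly_gen_ind: D f => [c|i|D1 D2 IH1 IH2|D1 D2 IH1 IH2] f.
- by rewrite lsubstC !diffopC linearZ.
- rewrite diffop_monomial mderivmU1m mderiv_lsubst lsubstX diffop_suml.
  congr lsubst; apply: eq_bigr => j _.
  by rewrite diffopZl diffop_monomial mderivmU1m mxE.
- by rewrite !diffopDl IH1 IH2 rmorphD /= diffopDl rmorphD.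
- by rewrite diffopM IH2 IH1 -diffopM -rmorphM.
Qed.

Lemma pairing_lsubst (C : fieldType) p q (A : 'M[C]_(p, q)) D f :
  pairing D (lsubst A f) = pairing (lsubst A^T D) f.
Proof. by rewrite /pairing diffop_lsubst lsubst_const. Qed.

Section PairingCharZero.
Variables (C : numFieldType) (n : nat).

Lemma pairing_eq0 (f : {mpoly C[n]}) : (forall D, pairing D f = 0) -> f = 0.
Proof.
move=> f0; apply/mpolyP => a; rewrite mcoeff0; apply/eqP.
have /eqP := f0 'X_[a]; rewrite pairingE msuppX big_seq1 mcoeffX eqxx mul1r.
rewrite mulf_eq0 pnatr_eq0.
by rewrite [mfact a == _]gtn_eqF ?mfact_gt0 // orbF.
Qed.

End PairingCharZero.

(** * Conjugation of coefficients and positivity *)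

Section Conjugation.
Variables (C : numClosedFieldType).

Definition cj n (f : {mpoly C[n]}) : {mpoly C[n]} := map_mpoly Num.conj f.
HB.instance Definition _ n := GRing.RMorphism.copy (@cj n) (map_mpoly Num.conj).

Lemma mcoeff_cj n (f : {mpoly C[n]}) a : (cj f)@_a = (f@_a)^*.
Proof. exact: mcoeff_map_mpoly. Qed.

Lemma cjZ n c (f : {mpoly C[n]}) : cj (c *: f) = c^* *: cj f.
Proof. exact: map_mpolyZ. Qed.

Lemma cjK n : involutive (@cj n).
Proof. by move=> f; apply/mpolyP => a; rewrite !mcoeff_cj conjCK. Qed.

Lemma cjX n (i : 'I_n) : cj 'X_i = 'X_i.
Proof. exact: map_mpolyX. Qed.

Lemma cj_pihomog n (f : {mpoly C[n]}) d : cj (pihomog mdeg d f) = pihomog mdeg d (cj f).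
Proof.
apply/mpolyP=> a; rewrite mcoeff_cj !mcoeff_pihomog mcoeff_cj.
by case: ifP; rewrite // rmorph0.
Qed.

Lemma cj_lsubst p q (A : 'M[C]_(p, q)) f :
  cj (lsubst A f) = lsubst (map_mx Num.conj A) (cj f).
Proof.
elim/mpoly_gen_ind: f => [c|i|f g IHf IHg|f g IHf IHg].
- by rewrite /cj lsubstC !map_mpolyC lsubstC.
- rewrite cjX !lsubstX rmorph_sum /=; apply: eq_bigr => j _.
  by rewrite cjZ cjX mxE.
- by rewrite !rmorphD /= IHf IHg.
- by rewrite !rmorphM /= IHf IHg.
Qed.

Lemma pairing_cj_sym n (f g : {mpoly C[n]}) :
  pairing (cj f) g = (pairing (cj g) f)^*.
Proof.
pose k := maxn (msize (cj f)) (msize (cj g)).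
rewrite (@pairing_widen _ _ k) ?leq_maxl // (@pairing_widen _ _ k (cj g)) ?leq_maxr //.
rewrite rmorph_sum /=.
apply: eq_bigr => a _; rewrite !mcoeff_cj !rmorphM /= conjCK conjC_nat.
by congr (_ * _); rewrite mulrC.
Qed.

(** The pairing of conj f with f is the sum of the a! |f_a|^2. *)
Lemma pairing_cj_eq0 n (f : {mpoly C[n]}) : pairing (cj f) f = 0 -> f = 0.
Proof.
rewrite pairingE => /eqP; rewrite psumr_eq0 => [|a _]; last first.
  rewrite mcoeff_cj mulrC mulr_ge0 ?ler0n // mulrC; exact: mul_conjC_ge0.
move=> /allP f0; apply/eqP; rewrite -msupp_eq0; apply/eqP.
case E: (msupp f) => [//|a s]; have fa: a \in msupp f by rewrite E mem_head.
have cfa: a \in msupp (cj f).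
  by move: fa; rewrite !mcoeff_msupp mcoeff_cj conjC_eq0.
have /eqP := f0 a cfa; rewrite mcoeff_cj => /eqP.
rewrite !mulf_eq0 conjC_eq0 orbb pnatr_eq0.
by rewrite mcoeff_eq0 fa [mfact a == _]gtn_eqF ?mfact_gt0.
Qed.

End Conjugation.

(** * Linear algebra over domains and fields *)

(** A, padded by zero columns into a square matrix, has determinant zero. *)
Lemma mx_left_kernel (R : idomainType) p q (A : 'M[R]_(p, q)) :
  (q < p)%N -> exists2 v : 'rV[R]_p, v != 0 & v *m A = 0.
Proof.
move=> lt_qp.
pose B := \matrix_(i < p, j < p) if insub (val j) is Some k then A i k else 0.
have detB0: \det B = 0.
  rewrite (expand_det_col B (Ordinal lt_qp)) big1 // => i _.
  by rewrite mxE insubF ?mul0r //= ltnn.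
have [v nzv vB0] := det0P (introT eqP detB0); exists v => //.
apply/rowP=> j; move/rowP/(_ (widen_ord (ltnW lt_qp) j)): vB0; rewrite !mxE => vB0.
by rewrite -[RHS]vB0; apply: eq_bigr => i _; rewrite mxE /= valK.
Qed.

Section FreeFamilies.
Variables (C : fieldType) (L : lmodType C).

Definition free_family k (b : 'I_k -> L) :=
  forall c : 'I_k -> C, \sum_i c i *: b i = 0 -> forall i, c i = 0.

(** A free family in P that cannot be extended inside P spans P; the bound makes
    successive extensions stop. *)
Lemma max_free_family (P : L -> Prop) B :
    (forall r (b : 'I_r -> L), (forall i, P (b i)) -> free_family b -> (r <= B)%N) ->
  exists r (b : 'I_r -> L), [/\ forall i, P (b i), free_family b
    & forall x, P x -> exists c : 'I_r -> C, x = \sum_i c i *: b i].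
Proof.
move=> leB.
suff ext d r (b : 'I_r -> L): (B < r + d)%N -> (forall i, P (b i)) ->
    free_family b -> exists r (b : 'I_r -> L), [/\ forall i, P (b i), free_family b
    & forall x, P x -> exists c : 'I_r -> C, x = \sum_i c i *: b i].
  by apply: (ext B.+1 0%N (fun _ => 0)) => [|[]|c _ []] //; rewrite add0n.
elim: d => [|d IHd] in r b * => lt_B Pb freeb.
  by have := leB r b Pb freeb; rewrite leqNgt -[r]addn0 lt_B.
have [spanb|] := classic (forall x, P x -> exists c, x = \sum_i c i *: b i).
  by exists r, b.
case/not_all_ex_not=> x nspan; have [Px {}nspan] := imply_to_and _ _ nspan.
pose b' (i : 'I_r.+1) := if unlift ord0 i is Some j then b j else x.
apply: (IHd _ b'); first by rewrite addSnnS.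
  by move=> i; rewrite /b'; case: unlift.
move=> c; rewrite big_ord_recl {1}/b' unlift_none.
rewrite (eq_bigr (fun i => c (lift ord0 i) *: b i)); last first.
  by move=> i _; rewrite /b' liftK.
move=> c0; have c00: c ord0 = 0.
  apply/eqP/negPn/negP => nzc; case: nspan.
  exists (fun i => - (c ord0)^-1 * c (lift ord0 i)).
  under eq_bigr do rewrite -scalerA; rewrite -scaler_sumr.
  apply: (scalerI nzc); rewrite scalerA mulrN divff // scaleN1r.
  by apply/eqP; rewrite -addr_eq0 c0.
move=> i; case: (unliftP ord0 i) => [j|] -> //.
by move: c0; rewrite c00 scale0r add0r => /freeb ->.
Qed.

End FreeFamilies.

Section OrthogonalProjection.
Variables (C : numClosedFieldType) (L : lmodType C) (h : L -> L -> C).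
Hypotheses (hD : forall u x y, h u (x + y) = h u x + h u y)
  (hZ : forall c u x, h u (c *: x) = c * h u x)
  (hC : forall u x, h u x = (h x u)^*)
  (h_anis : forall u, h u u = 0 -> u = 0).

(** The Gram matrix of a free family is invertible: a vector in its kernel would
    be the coordinates of an isotropic vector. *)
Lemma orthogonal_projection r (b : 'I_r -> L) : free_family b ->
  forall x, exists c : 'I_r -> C, forall i, h (b i) (x - \sum_j c j *: b j) = 0.
Proof.
move=> freeb x; pose M := \matrix_(i, j) h (b i) (b j).
have h0 u: h u 0 = 0 by rewrite -(scale0r 0) hZ mul0r.
have hS u (c : 'I_r -> C): h u (\sum_j c j *: b j) = \sum_j c j * h u (b j).
  by rewrite (big_morph (h u) (hD u) (h0 u)); apply: eq_bigr => j _; rewrite hZ.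
have unitM: M \in unitmx.
  rewrite unitmxE unitfE -det_tr; apply/det0P => -[v nzv vM].
  pose y := \sum_j v 0 j *: b j.
  have yb i: h (b i) y = 0.
    move/rowP/(_ i): vM; rewrite !mxE hS => vM; rewrite -[RHS]vM.
    by apply: eq_bigr => j _; rewrite !mxE.
  have /h_anis/freeb v0: h y y = 0.
    by rewrite {2}/y hS big1 // => j _; rewrite hC yb conjC0 mulr0.
  by case/eqP: nzv; apply/rowP=> j; rewrite v0 mxE.
pose c := invmx M *m \col_i h (b i) x.
exists (fun j => c j 0) => i; rewrite hD -scaleN1r hZ hS mulN1r.
apply/eqP; rewrite subr_eq0; apply/eqP.
transitivity ((M *m c) i 0); first by rewrite mulmxA mulmxV // mul1mx mxE.
by rewrite mxE; apply: eq_bigr => j _; rewrite mxE mulrC.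
Qed.

End OrthogonalProjection.

(** Leaving the set A of scalars arbitrary covers both the S^G-span of a set of
    vectors and the ideal generated by A, where the vectors are the cofactors. *)
Inductive lspan (R : pzRingType) (M : lmodType R) (A : R -> Prop) (P : M -> Prop) :
  M -> Prop :=
| lspan0 : lspan A P 0
| lspanD a x y : A a -> P x -> lspan A P y -> lspan A P (a *: x + y).

Section LSpan.
Variables (R : comPzRingType) (M : lmodType R) (A : R -> Prop) (P : M -> Prop).

Lemma lspan_gen a x : A a -> P x -> lspan A P (a *: x).
Proof. by move=> Aa Px; rewrite -[_ *: _]addr0; apply: lspanD => //; apply: lspan0. Qed.

Lemma lspan_add x y : lspan A P x -> lspan A P y -> lspan A P (x + y).
Proof.
move=> Ax Ay; elim: Ax => [|a u v Aa Pu _ IH]; first by rewrite add0r.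
by rewrite -addrA; apply: lspanD.
Qed.

Lemma lspan_sum I (r : seq I) (Q : pred I) F :
  (forall i, Q i -> lspan A P (F i)) -> lspan A P (\sum_(i <- r | Q i) F i).
Proof. by move=> AF; apply: big_ind => //; [apply: lspan0 | apply: lspan_add]. Qed.

Lemma lspan_scale_gen c x :
  (forall y, P y -> P (c *: y)) -> lspan A P x -> lspan A P (c *: x).
Proof.
move=> Pc; elim=> [|a u v Aa Pu _ IH]; first by rewrite scaler0; apply: lspan0.
rewrite scalerDr scalerA mulrC -scalerA; apply: lspanD => //; exact: Pc.
Qed.

Lemma lspan_scale_coef c x :
  (forall a, A a -> A (c * a)) -> lspan A P x -> lspan A P (c *: x).
Proof.
move=> Ac; elim=> [|a u v Aa Pu _ IH]; first by rewrite scaler0; apply: lspan0.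
rewrite scalerDr scalerA; apply: lspanD => //; exact: Ac.
Qed.

End LSpan.

(** * Harmonic polynomials as an orthogonal complement *)

Section Harmonics.
Variables (C : numClosedFieldType) (gT : finGroupType) (G : {group gT}) (n : nat).
Variable rV : mx_representation C G n.
Local Notation S := {mpoly C[n]}.
Implicit Types f u : S.

Definition gact g f : S := lsubst (rV g^-1%g) f.

HB.instance Definition _ g :=
  GRing.LRMorphism.copy (gact g) (lsubst (rV g^-1%g)).

Lemma poly_actE g f : poly_act rV g f = gact g f.
Proof. by rewrite /gact unlock. Qed.

Lemma dual_poly_actE g f : poly_act (dual_repr rV) g f = lsubst (rV g)^T f.
Proof. by rewrite unlock /poly_act /= /dual_mx invgK. Qed.

Lemma gactC g c : gact g c%:MP = c%:MP.
Proof. exact: lsubstC. Qed.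

Lemma gact1 f : gact 1%g f = f.
Proof. by rewrite /gact invg1 repr_mx1 lsubst1. Qed.

Lemma gactM g h f : g \in G -> h \in G -> gact (g * h)%g f = gact g (gact h f).
Proof.
by move=> Gg Gh; rewrite !/gact lsubst_comp invMg repr_mxM ?groupV.
Qed.

Definition is_invariant f := forall g, g \in G -> gact g f = f.

Lemma invariantC c : is_invariant c%:MP.
Proof. by move=> g _; apply: gactC. Qed.

Lemma invariant0 : is_invariant 0.
Proof. by move=> g _; rewrite raddf0. Qed.

Lemma invariant1 : is_invariant 1.
Proof. by move=> g _; rewrite rmorph1. Qed.

Lemma invariantD f h : is_invariant f -> is_invariant h -> is_invariant (f + h).
Proof. by move=> If Ih g Gg; rewrite raddfD /= If ?Ih. Qed.

Lemma invariantN f : is_invariant f -> is_invariant (- f).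
Proof. by move=> If g Gg; rewrite raddfN /= If. Qed.

Lemma invariantM f h : is_invariant f -> is_invariant h -> is_invariant (f * h).
Proof. by move=> If Ih g Gg; rewrite rmorphM /= If ?Ih. Qed.

Lemma invariantZ c f : is_invariant f -> is_invariant (c *: f).
Proof. by move=> If g Gg; rewrite linearZ /= If. Qed.

Lemma invariant_pihomog d f : is_invariant f -> is_invariant (pihomog mdeg d f).
Proof. by move=> If g Gg; rewrite /gact -pihomog_lsubst -/(gact _ _) If. Qed.

Definition transfer f := \sum_(g in G) gact g f.
Definition reynolds f := #|G|%:R^-1 *: transfer f.

Lemma transfer_invariant f : is_invariant (transfer f).
Proof.
move=> g Gg; rewrite raddf_sum /= /transfer [RHS](reindex_inj (mulgI g)) /=.
under [RHS]eq_bigl do rewrite groupMl //.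
by apply: eq_bigr => h Gh; rewrite gactM.
Qed.

Lemma transferM f h : is_invariant f -> transfer (f * h) = f * transfer h.
Proof.
by move=> If; rewrite mulr_sumr; apply: eq_bigr => g Gg; rewrite rmorphM /= If.
Qed.

Lemma reynolds_invariant f : is_invariant (reynolds f).
Proof. by apply: invariantZ; apply: transfer_invariant. Qed.

Lemma reynolds_id f : is_invariant f -> reynolds f = f.
Proof.
move=> If; rewrite /reynolds /transfer (eq_bigr (fun _ => f)) // sumr_const -scaler_nat.
by rewrite scalerA mulVf ?scale1r // pnatr_eq0 -lt0n cardG_gt0.
Qed.

Lemma reynoldsD f h : reynolds (f + h) = reynolds f + reynolds h.
Proof.
rewrite -scalerDr -big_split; congr (_ *: _).
by apply: eq_bigr => g _; rewrite raddfD.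
Qed.

Lemma reynolds_sum I (r : seq I) (P : pred I) F :
  reynolds (\sum_(i <- r | P i) F i) = \sum_(i <- r | P i) reynolds (F i).
Proof.
apply: (big_morph _ reynoldsD).
by rewrite /reynolds /transfer big1 ?scaler0 // => g _; rewrite raddf0.
Qed.

Lemma reynoldsM f h : is_invariant f -> reynolds (f * h) = f * reynolds h.
Proof. by move=> If; rewrite /reynolds transferM // scalerAr. Qed.

(** Cofactors are arbitrary, so this is the ideal of S generated by the invariants
    without constant term. *)
Definition hilbert_ideal : S -> Prop :=
  @lspan S S^o (fun a => is_invariant a /\ a@_0%MM = 0) (fun=> True).

Lemma hilbert_idealMl f h : hilbert_ideal h -> hilbert_ideal (f * h).
Proof. by move=> Ih; apply: (@lspan_scale_gen _ S^o _ _ f). Qed.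

Lemma hilbert_idealD f h : hilbert_ideal f -> hilbert_ideal h -> hilbert_ideal (f + h).
Proof. exact: lspan_add. Qed.

Lemma hilbert_idealN f : hilbert_ideal f -> hilbert_ideal (- f).
Proof. by move=> If; rewrite -mulN1r; apply: hilbert_idealMl. Qed.

Lemma hilbert_idealZ c f : hilbert_ideal f -> hilbert_ideal (c *: f).
Proof. by move=> If; rewrite -mul_mpolyC; apply: hilbert_idealMl. Qed.

Lemma hilbert_ideal0 : hilbert_ideal 0.
Proof. exact: lspan0. Qed.

Lemma hilbert_ideal_sum I (r : seq I) (P : pred I) F :
  (forall i, P i -> hilbert_ideal (F i)) -> hilbert_ideal (\sum_(i <- r | P i) F i).
Proof. exact: lspan_sum. Qed.

Lemma hilbert_ideal_gen a f : is_invariant a -> a@_0%MM = 0 -> hilbert_ideal (a * f).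
Proof. by move=> Ia a0; apply: (@lspan_gen _ S^o). Qed.

Lemma hilbert_ideal_act g f : g \in G -> hilbert_ideal f -> hilbert_ideal (gact g f).
Proof.
move=> Gg; elim=> [|a x y [Ia a0] _ _ IH]; first by rewrite raddf0; apply: lspan0.
rewrite raddfD /=; apply: hilbert_idealD IH.
by rewrite rmorphM /= Ia //; apply: hilbert_ideal_gen.
Qed.

Lemma pihomogM d e (f h : S) : f \is e.-homog ->
  pihomog mdeg d (f * h) = if (e <= d)%N then f * pihomog mdeg (d - e) h else 0.
Proof.
move=> homf; pose k := maxn d.+1 (msize h).
have ->: f * h = \sum_(i < k) f * pihomog mdeg i h.
  by rewrite -mulr_sumr -pihomog_partitionE // leq_maxr.
have homfh i: f * pihomog mdeg i h \is (e + i).-homog.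
  by apply: dhomogM => //; apply: pihomogP.
rewrite raddf_sum /=; case: leqP => [le_ed|lt_de].
  have lt_k: (d - e < k)%N by rewrite leq_max ltnS leq_subr.
  rewrite (bigD1 (Ordinal lt_k)) //= pihomog_dE.
    rewrite big1 ?addr0 // => i ne_i; apply: pihomog_ne0 (homfh i).
    by apply: contraNneq ne_i => Ed; apply/eqP/val_inj; rewrite /= -Ed addKn.
  by have:= homfh (d - e)%N; rewrite subnKC.
rewrite big1 // => i _; apply: pihomog_ne0 (homfh i).
by rewrite gtn_eqF // (leq_trans lt_de) ?leq_addr.
Qed.

Lemma homog_const0 d (f : S) : f \is d.-homog -> (0 < d)%N -> f@_0%MM = 0.
Proof.
move=> homf d_gt0; apply: (dhomog_nemf_coeff homf).
by rewrite -[X in X != _]/(mdeg 0) mdeg0 eq_sym -lt0n.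
Qed.

Lemma const_pihomog0 (f : S) : f@_0%MM = 0 -> pihomog mdeg 0 f = 0.
Proof.
move=> f0; apply/mpolyP => m; rewrite mcoeff_pihomog mcoeff0 mdeg_eq0.
by case: eqP => // ->.
Qed.

Lemma hilbert_ideal_pihomog d f : hilbert_ideal f -> hilbert_ideal (pihomog mdeg d f).
Proof.
elim=> [|a x y [Ia a0] _ _ IH]; first by rewrite raddf0; apply: lspan0.
rewrite raddfD /=; apply: hilbert_idealD IH; rewrite /GRing.scale /=.
rewrite {1}(pihomog_partitionE (leqnn (msize a))) mulr_suml raddf_sum /=.
apply: hilbert_ideal_sum => -[[|i] /= _] _.
  by rewrite const_pihomog0 // mul0r raddf0; apply: hilbert_ideal0.
rewrite (@pihomogM _ i.+1) ?pihomogP //; case: ifP => _; last exact: hilbert_ideal0.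
apply: hilbert_ideal_gen; first exact: invariant_pihomog.
by apply: homog_const0 (pihomogP _ _ _) _.
Qed.

(** The matrix of a G-invariant positive definite Hermitian form on V^*. *)
Let B : 'M[C]_n := \sum_(g in G) map_mx Num.conj (rV g) *m (rV g)^T.

Lemma gram_invariant g : g \in G -> map_mx Num.conj (rV g) *m B *m (rV g)^T = B.
Proof.
move=> Gg; rewrite /B mulmx_sumr mulmx_suml [RHS](reindex_inj (mulgI g)) /=.
under [RHS]eq_bigl do rewrite groupMl //.
apply: eq_bigr => h Gh; rewrite repr_mxM // map_mxM trmx_mul !mulmxA.
by [].
Qed.

(** The conjugate-linear G-equivariant isomorphism of S(V^* ) with S(V) induced
    by the form B. *)
Definition to_symbol u : S := lsubst B (cj u).

(** For this form the operator of symbol to_symbol u is adjoint to multiplication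
    by u. *)
Definition hform u f := pairing (to_symbol u) f.

HB.instance Definition _ := GRing.RMorphism.copy to_symbol (lsubst B \o @cj C n).

(** X is made of the blocks rV g, side by side, so that B = conj X *m X^T; this
    rectangular square root of B shows the positivity of hform. *)
Let K := setX G [set: 'I_n].
Let X : 'M[C]_(n, #|K|) :=
  \matrix_(i, k) rV (enum_val k).1 i (enum_val k).2.
Let Y : 'M[C]_(#|K|, n) :=
  \matrix_(k, j) (enum_val k == (1%g, j))%:R.

Lemma gram_factor : B = map_mx Num.conj X *m X^T.
Proof.
apply/matrixP=> i j; rewrite /B summxE mxE.
under [RHS]eq_bigr do rewrite !mxE.
rewrite -(big_enum_val (fun x => (rV x.1 i x.2)^* * rV x.1 j x.2)) /=.
rewrite (eq_bigl (fun x => (x.1 \in G) && true)) => [|x]; last first.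
  by rewrite !inE andbT.
rewrite -(pair_big (mem G) xpredT (fun g k => (rV g i k)^* * rV g j k)) /=.
by apply: eq_bigr => g _; rewrite mxE; apply: eq_bigr => k _; rewrite !mxE.
Qed.

Lemma gram_factor_section : X *m Y = 1%:M.
Proof.
apply/matrixP=> i j; rewrite !mxE.
under eq_bigr do rewrite !mxE.
rewrite -(big_enum_val (fun x => rV x.1 i x.2 * (x == (1%g, j))%:R)) /=.
rewrite (bigD1 (1%g, j)) ?inE ?group1 //= eqxx mulr1 big1 ?addr0.
  by rewrite repr_mx1 mxE.
by move=> x /andP[_ /negPf->]; rewrite mulr0.
Qed.

Lemma hformE u f : hform u f = pairing (cj (lsubst X u)) (lsubst X f).
Proof.
by rewrite /hform /to_symbol gram_factor -lsubst_comp cj_lsubst pairing_lsubst.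
Qed.

Lemma hformC u f : hform u f = (hform f u)^*.
Proof. rewrite !hformE; exact: pairing_cj_sym. Qed.

(** hform is the pull-back by f |-> f o X of the standard form in n #|G|
    variables, and this map is injective since X has a right inverse. *)
Lemma hform_anisotropic u : hform u u = 0 -> u = 0.
Proof.
rewrite hformE => /pairing_cj_eq0 Xu0.
by rewrite -[u]lsubst1 -gram_factor_section -lsubst_comp Xu0 raddf0.
Qed.

Lemma hformDr u f h : hform u (f + h) = hform u f + hform u h.
Proof. by rewrite /hform /pairing raddfD mcoeffD. Qed.

Lemma hformZr c u f : hform u (c *: f) = c * hform u f.
Proof. by rewrite /hform /pairing linearZ mcoeffZ. Qed.

Lemma hform0r u : hform u 0 = 0.
Proof. by rewrite /hform /pairing raddf0 mcoeff0. Qed.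

Lemma hform_pihomog d u f : hform u (pihomog mdeg d f) = hform (pihomog mdeg d u) f.
Proof.
by rewrite /hform -pairing_pihomog /to_symbol pihomog_lsubst cj_pihomog.
Qed.

(** A row v killed by B gives an isotropic linear form, of coefficients conj v. *)
Lemma gram_unit : B \in unitmx.
Proof.
rewrite unitmxE unitfE; apply/det0P => -[v nzv vB0].
pose u : S := \sum_i (v 0 i)^* *: 'X_i.
have /hform_anisotropic u0: hform u u = 0.
  rewrite /hform /to_symbol (_ : cj u = \sum_i v 0 i *: 'X_i); last first.
    by rewrite /u (raddf_sum (@cj C n)); apply: eq_bigr => i _; rewrite /= cjZ conjCK cjX.
  rewrite lsubst_linform big1 ?/pairing => [|j _]; last first.
    by move/rowP/(_ j): vB0; rewrite !mxE => ->; rewrite scale0r.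
  by rewrite -(scale0r 0) diffopZl scale0r mcoeff0.
case/eqP: nzv; apply/rowP=> i; rewrite mxE; apply/eqP; rewrite -conjC_eq0.
have /(congr1 (mcoeff U_(i)%MM)) := u0; rewrite mcoeff0 raddf_sum (bigD1 i) //=.
rewrite mcoeffZ mcoeffX eqxx mulr1 big1 ?addr0 => [->//|j ne_ji].
by rewrite mcoeffZ mcoeffX eq_mnm1 (negPf ne_ji) mulr0.
Qed.

Lemma to_symbol_invariant u : is_invariant u -> invariant_diffop rV (to_symbol u).
Proof.
move=> Iu g Gg; rewrite dual_poly_actE.
have Eu: lsubst (rV g) u = u by have := Iu g^-1%g; rewrite groupV /gact invgK => ->.
rewrite /to_symbol -[in LHS]Eu cj_lsubst !lsubst_comp.
by rewrite ?mulmxA gram_invariant.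
Qed.

Lemma to_symbol_const u : (to_symbol u)@_0%MM = (u@_0%MM)^*.
Proof. by rewrite /to_symbol lsubst_const mcoeff_cj. Qed.

Lemma to_symbol_surj D : exists u, to_symbol u = D.
Proof.
exists (cj (lsubst (invmx B) D)).
by rewrite /to_symbol cjK lsubst_comp mulVmx ?gram_unit // lsubst1.
Qed.

Lemma to_symbol_inj : injective to_symbol.
Proof.
move=> u v /(congr1 (lsubst (invmx B))).
rewrite /to_symbol !lsubst_comp (mulmxV gram_unit) !lsubst1.
exact: (can_inj (@cjK C n)).
Qed.

Lemma invariant_to_symbol u : invariant_diffop rV (to_symbol u) -> is_invariant u.
Proof.
move=> Iu g Gg; apply: to_symbol_inj.
have inv_tr h: h \in G -> lsubst (rV h)^T (to_symbol u) = to_symbol u.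
  by move=> Gh; rewrite -dual_poly_actE; apply: Iu.
rewrite -[RHS](inv_tr g Gg).
rewrite /to_symbol /gact cj_lsubst !lsubst_comp.
rewrite -[X in X *m (rV g)^T](gram_invariant (groupVr Gg)) -!mulmxA -trmx_mul.
by rewrite -(repr_mxM rV Gg (groupVr Gg)) mulgV repr_mx1 trmx1 mulmx1.
Qed.

(** Operators with invariant symbol are adjoint to multiplication by invariants:
    those without constant term annihilate f if and only if f is orthogonal to
    all multiples of the invariants without constant term. *)
Lemma harmonic_orthogonal f :
  harmonic rV f <-> forall u, hilbert_ideal u -> hform u f = 0.
Proof.
split=> [harm_f u | orth_f D inv_D D0].
  elim=> [|a x y [Ia a0] _ _ IH]; first by rewrite hformC hform0r conjC0.
  rewrite hformC hformDr rmorphD /= -!hformC IH addr0 /hform.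
  rewrite [to_symbol _]rmorphM mulrC pairingM harm_f.
  - by rewrite /pairing raddf0 mcoeff0.
  - exact: to_symbol_invariant.
  - by rewrite to_symbol_const a0 conjC0.
apply: pairing_eq0 => E; rewrite -pairingM.
have [e <-] := to_symbol_surj E; have [a Da] := to_symbol_surj D.
rewrite -Da -rmorphM /= mulrC; apply: orth_f.
apply: hilbert_ideal_gen; first by apply: invariant_to_symbol; rewrite Da.
by apply/eqP; rewrite -conjC_eq0 -to_symbol_const Da D0.
Qed.

Lemma harmonicD f u : harmonic rV f -> harmonic rV u -> harmonic rV (f + u).
Proof. by move=> hf hu D ID D0; rewrite raddfD /= hf ?hu ?addr0. Qed.

Lemma harmonicZ c f : harmonic rV f -> harmonic rV (c *: f).
Proof. by move=> hf D ID D0; rewrite linearZ /= hf ?scaler0. Qed.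

Lemma harmonic0 : harmonic rV 0.
Proof. by move=> D _ _; rewrite raddf0. Qed.

Lemma harmonic_sum I (r : seq I) (P : pred I) F :
  (forall i, P i -> harmonic rV (F i)) -> harmonic rV (\sum_(i <- r | P i) F i).
Proof. by move=> hF; apply: big_ind => //; [apply: harmonic0 | apply: harmonicD]. Qed.

Lemma harmonic_act g f : g \in G -> harmonic rV f -> harmonic rV (gact g f).
Proof.
move=> Gg hf D ID D0; rewrite /gact diffop_lsubst hf ?raddf0 //; last first.
  by rewrite lsubst_const.
suff ->: lsubst (rV g^-1%g)^T D = D by [].
by rewrite -dual_poly_actE; apply: ID; rewrite groupV.
Qed.

Lemma harmonic_pihomog d f : harmonic rV f -> harmonic rV (pihomog mdeg d f).
Proof.
rewrite !harmonic_orthogonal => orth u Iu.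
by rewrite hform_pihomog orth //; apply: hilbert_ideal_pihomog.
Qed.

Lemma harmonic_ideal0 f : harmonic rV f -> hilbert_ideal f -> f = 0.
Proof. by move/harmonic_orthogonal=> orth /orth/hform_anisotropic. Qed.

(** In the finite-dimensional space of homogeneous polynomials of degree d, project
    f orthogonally onto the degree d part of the ideal. *)
Lemma homog_harmonic_ideal d f : f \is d.-homog ->
  exists p q, [/\ f = p + q, harmonic rV p, hilbert_ideal q & q \is d.-homog].
Proof.
move=> homf.
(* Free families are bounded by the number of monomials of degree at most d. *)
have [|r [b [Pb freeb spanb]]] :=
  @max_free_family C S (fun u => hilbert_ideal u /\ u \is d.-homog) #|{: 'X_{1..n < d.+1}}|.
  move=> r b homb freeb; rewrite leqNgt; apply/negP => lt_r.
  pose A := \matrix_(i < r, k < #|{: 'X_{1..n < d.+1}}|) (b i)@_(enum_val k : 'X_{1..n}).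
  have [v nzv vA0] := mx_left_kernel A lt_r; case/eqP: nzv.
  apply/rowP=> i; rewrite mxE; apply: (freeb (v 0)); apply/mpolyP => m.
  rewrite mcoeff0 raddf_sum /=; have [le_m | lt_m] := leqP (mdeg m) d.
    have lt_m: (mdeg m < d.+1)%N by [].
    pose k := enum_rank (BMultinom lt_m : 'X_{1..n < d.+1}).
    move/rowP/(_ k): vA0; rewrite !mxE => vA0; rewrite -[RHS]vA0.
    by apply: eq_bigr => j _; rewrite mcoeffZ mxE enum_rankK.
  rewrite big1 // => j _; rewrite mcoeffZ (dhomog_nemf_coeff (homb j).2) ?mulr0 //.
  by rewrite -[X in X != _]/(mdeg m) gtn_eqF.
have [c cE] := orthogonal_projection hformDr hformZr hformC hform_anisotropic freeb f.
set q := \sum_j _ in cE; have homq: q \is d.-homog.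
  by apply: rpred_sum => j _; apply: rpredZ; case: (Pb j).
exists (f - q), q; split=> //; first by rewrite subrK.
  apply/harmonic_orthogonal => u Iu.
  have <-: pihomog mdeg d (f - q) = f - q by apply: pihomog_dE; apply: rpredB.
  have [|e Eu] := spanb (pihomog mdeg d u).
    by split; [apply: hilbert_ideal_pihomog | apply: pihomogP].
  rewrite hform_pihomog Eu hformC.
  rewrite (big_morph _ (hformDr (f - q)) (hform0r _)) big1 ?conjC0 // => j _.
  by rewrite hformZr hformC cE conjC0 mulr0.
by apply: hilbert_ideal_sum => j _; apply: hilbert_idealZ; case: (Pb j).
Qed.

(** Harmonic polynomials generate S(V^* ) over the invariants: graded Nakayama,
    peeling off the harmonic part of each homogeneous component and recursing on
    the lower-degree cofactors of the rest. *)
Lemma harmonics_generate f : @lspan S S^o is_invariant (harmonic rV) f.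
Proof.
move: {2}(msize f) (leqnn (msize f)) => k; elim/ltn_ind: k f => k IHk f le_fk.
rewrite (pihomog_partitionE le_fk); apply: lspan_sum => d _.
have [p [q [-> harm_p Iq homq]]] := homog_harmonic_ideal (pihomogP mdeg d f).
apply: lspan_add.
  by rewrite -[p](@scale1r S S^o); apply: lspan_gen => //; apply: invariant1.
rewrite -(pihomog_dE homq); elim: Iq => [|a x y [Ia a0] _ _ IHy].
  by rewrite raddf0; apply: lspan0.
rewrite raddfD /=; apply: lspan_add IHy; rewrite /GRing.scale /=.
rewrite (pihomog_partitionE (leqnn (msize a))) mulr_suml raddf_sum /=.
apply: lspan_sum => -[[|i] /= _] _.
  by rewrite const_pihomog0 // mul0r raddf0; apply: lspan0.
rewrite (@pihomogM _ i.+1) ?pihomogP //; case: ifP => [lt_id|_]; last exact: lspan0.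
apply: (@lspan_scale_coef _ S^o).
  by move=> b; apply: invariantM; apply: invariant_pihomog.
apply: (IHk (d - i)%N); last first.
  apply: leq_trans (msize_homog_le (pihomogP _ _ _)) _.
  by rewrite -subSn // subSS.
by apply: leq_ltn_trans (leq_subr _ _) _; apply: ltn_ord.
Qed.

End Harmonics.

(** * Freeness over the invariants of a reflection group *)

Section Reflections.
Variables (C : numClosedFieldType) (gT : finGroupType) (G : {group gT}) (n : nat).
Variable rV : mx_representation C G n.
Local Notation S := {mpoly C[n]}.
Local Notation gact := (gact rV).
Local Notation is_invariant := (is_invariant rV).
Local Notation hilbert_ideal := (hilbert_ideal rV).
Implicit Types f u : S.

(** The matrix s^-1 - 1 vanishes on the hyperplane of s, so it is a column times
    the row a: s moves each coordinate by a multiple of the form a.  The identity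
    s (f u) - f u = s f (s u - u) + (s f - f) u extends this to S. *)
Lemma divided_difference s : s \in G -> is_reflection rV s ->
  exists l : S, [/\ l != 0, l \is 1.-homog
    & forall f, exists q, gact s f - f = l * q].
Proof.
move=> Gs [a [nza fix_a]]; exists (\sum_j a 0 j *: 'X_j).
have /submxP[w Ew]: (rV s^-1%g - 1%:M <= a)%MS.
  rewrite submxE; apply/eqP/matrixP=> i k; rewrite [in RHS]mxE.
  have /(congr1 (mulmx (rV s^-1%g))): rV s *m col k (cokermx a) = col k (cokermx a).
    by apply: fix_a; rewrite colE mulmxA mulmx_coker mul0mx.
  rewrite mulmxA -repr_mxM ?groupV // mulVg repr_mx1 mul1mx => E.
  transitivity (((rV s^-1%g - 1%:M) *m col k (cokermx a)) i 0).
    by rewrite !mxE; apply: eq_bigr => j _; rewrite !mxE.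
  by rewrite mulmxBl mul1mx -E subrr mxE.
split.
- have /rV0Pn[j nzaj] := nza; apply: contraNneq nzaj => /(congr1 (mcoeff U_(j)%MM)).
  rewrite raddf_sum mcoeff0 (bigD1 j) //= mcoeffZ mcoeffXU eqxx mulr1 big1 ?addr0.
    by move->.
  by move=> i ne_ij; rewrite mcoeffZ mcoeffXU (negPf ne_ij) mulr0.
- by apply: rpred_sum => j _; apply: rpredZ; rewrite dhomogX; apply/eqP/mdeg1.
elim/mpoly_gen_ind=> [c|i|f u [q Eq] [p Ep]|f u [q Eq] [p Ep]].
- by exists 0; rewrite gactC subrr mulr0.
- exists (w i 0)%:MP; rewrite /gact lsubstX mulrC mul_mpolyC scaler_sumr.
  have ->: 'X_i = \sum_j (1%:M : 'M[C]_n) i j *: 'X_j :> S.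
    by rewrite -lsubstX lsubst1.
  rewrite -sumrB; apply: eq_bigr => j _; rewrite -scalerBl scalerA.
  by move/matrixP/(_ i j): Ew; rewrite !mxE big_ord1 => ->.
- by exists (q + p); rewrite raddfD mulrDr -Eq -Ep opprD addrACA.
- exists (gact s f * p + q * u); rewrite rmorphM /= mulrDr mulrCA -Ep mulrA -Eq.
  by rewrite mulrBr mulrBl addrA subrK.
Qed.

Lemma hilbert_ideal_const f : hilbert_ideal f -> f@_0%MM = 0.
Proof.
elim=> [|a x y [_ a0] _ _ IH]; first exact: mcoeff0.
by rewrite mcoeffD IH addr0 [LHS](rmorphM (mcoeff 0%MM)) /= a0 mul0r.
Qed.

Hypothesis reflG : generated_by_reflections rV.

Lemma hilbert_ideal_act_sub f :
    (forall s, s \in G -> is_reflection rV s -> hilbert_ideal (gact s f - f)) ->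
  forall g, g \in G -> hilbert_ideal (gact g f - f).
Proof.
case: reflG => A [reflA defG] If g; rewrite -defG => /gen_prodgP[r [c Ac ->]].
pose P x := x \in G /\ hilbert_ideal (gact x f - f).
suff []: P (\prod_(i < r) c i)%g by [].
apply: (big_ind P) => [|x y [Gx Ix] [Gy Iy]|i _]; rewrite /P.
- by rewrite group1 gact1 subrr; split=> //; apply: hilbert_ideal0.
- split; first exact: groupM.
  have ->: gact (x * y)%g f - f = gact x (gact y f - f) + (gact x f - f).
    by rewrite raddfB /= gactM // addrA subrK.
  apply: hilbert_idealD Ix; exact: hilbert_ideal_act.
have Gc: c i \in G by rewrite -defG mem_gen.
by split=> //; apply: If => //; apply: reflA.
Qed.

(** Chevalley's lemma, localized at the origin so as to hold for inhomogeneous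
    relations.  Divided differences turn the relation into one with
    a smaller p0; by induction s p0 - p0 is in the ideal for all reflections s,
    so p0 is congruent to its average, hence to a constant c.  If c is not zero
    then p0 itself, whose value at 0 is c, can be taken as u. *)
Lemma chevalley r (h p : 'I_r -> S) h0 p0 :
    (forall i, is_invariant (h i)) -> is_invariant h0 ->
    \sum_i h i * p i + h0 * p0 = 0 ->
  hilbert_ideal p0 \/
  exists u (s : 'I_r -> S), u@_0%MM != 0 /\ u * h0 = \sum_i s i * h i.
Proof.
move=> Ih Ih0 rel.
have [|nloc] := classic (exists u (s : 'I_r -> S),
  u@_0%MM != 0 /\ u * h0 = \sum_i s i * h i); [by right | left].
move: {2}(msize p0) (leqnn (msize p0)) => k.
elim: k => [|k IHk] in p p0 rel *.
  by rewrite leqn0 msize_poly_eq0 => /eqP ->; apply: hilbert_ideal0.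
move=> le_p0; have act_sub: forall g, g \in G -> hilbert_ideal (gact g p0 - p0).
  apply: hilbert_ideal_act_sub => s Gs /(divided_difference Gs)[l [nzl homl divl]].
  have /fin_all_exists[q Eq] := fun i => divl (p i).
  have [q0 Eq0] := divl p0; rewrite Eq0; apply: hilbert_idealMl.
  apply: (IHk q).
    apply: (mulfI nzl); rewrite mulr0 mulrDr mulr_sumr.
    transitivity (gact s (\sum_i h i * p i + h0 * p0) - (\sum_i h i * p i + h0 * p0)).
      rewrite raddfD raddf_sum /= rmorphM /= Ih0 // opprD addrACA -mulrBr Eq0 mulrCA.
      congr (_ + _); rewrite -sumrB; apply: eq_bigr => i _.
      by rewrite rmorphM /= Ih // -mulrBr Eq mulrCA.
    by rewrite rel raddf0 subrr.
  have [->|nzq0] := eqVneq q0 0; first by rewrite msize0.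
  have: (msize (l * q0) <= msize p0)%N.
    rewrite -Eq0 (leq_trans (msizeD_le _ _)) // geq_max msizeN leqnn andbT.
    exact: msize_lsubst.
  by rewrite msizeM // (msize_homog nzl homl) /= => /leq_trans/(_ le_p0).
pose c := (reynolds rV p0)@_0%MM.
have Ip0c: hilbert_ideal (p0 - c%:MP).
  have ->: p0 - c%:MP = (reynolds rV p0 - c%:MP) * 1 - (reynolds rV p0 - p0).
    by rewrite mulr1 opprB [RHS]addrC addrA subrK.
  apply: hilbert_idealD; first apply: hilbert_ideal_gen.
  - by apply: invariantD; [apply: reynolds_invariant | apply/invariantN/invariantC].
  - by rewrite mcoeffB mcoeffC eqxx mulr1 subrr.
  apply: hilbert_idealN; rewrite -{2}[p0]scale1r.
  have nzG: #|G|%:R != 0 :> C by rewrite pnatr_eq0 -lt0n cardG_gt0.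
  rewrite -(mulVf nzG) -scalerA -scalerBr; apply: hilbert_idealZ.
  rewrite scaler_nat -sumr_const -sumrB; exact: hilbert_ideal_sum.
have [c0|nzc] := eqVneq c 0; first by rewrite c0 mpolyC0 subr0 in Ip0c.
case: nloc; exists p0, (fun i => - p i); split.
  have := hilbert_ideal_const Ip0c.
  by rewrite mcoeffB mcoeffC eqxx mulr1 => /eqP; rewrite subr_eq0 => /eqP ->.
apply/eqP; rewrite -subr_eq0 -sumrN mulrC addrC.
under eq_bigr do rewrite mulNr opprK mulrC.
by rewrite rel.
Qed.

Lemma norm_invariant u : is_invariant (\prod_(g in G) gact g u).
Proof.
move=> g Gg; rewrite rmorph_prod /= [RHS](reindex_inj (mulgI g)) /=.
under [RHS]eq_bigl do rewrite groupMl //.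
by apply: eq_bigr => h Gh; rewrite gactM.
Qed.

(** Replace u by the product of its conjugates, then average the coefficients. *)
Lemma chevalley_invariant r (h p : 'I_r -> S) h0 p0 :
    (forall i, is_invariant (h i)) -> is_invariant h0 ->
    \sum_i h i * p i + h0 * p0 = 0 -> ~ hilbert_ideal p0 ->
  exists u (s : 'I_r -> S), [/\ u@_0%MM != 0, is_invariant u,
    forall i, is_invariant (s i) & u * h0 = \sum_i s i * h i].
Proof.
move=> Ih Ih0 rel nIp0; have [//|[u [s [nzu Eu]]]] := chevalley Ih Ih0 rel.
pose v := \prod_(g in G | g != 1%g) gact g u.
have Euv: \prod_(g in G) gact g u = v * u.
  by rewrite (bigD1 1%g) ?group1 //= gact1 mulrC.
exists (v * u), (fun i => reynolds rV (v * s i)); rewrite -{1 2}Euv; split.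
- rewrite (rmorph_prod (mcoeff 0%MM)) /=; apply/prodf_neq0 => g _.
  by rewrite /gact lsubst_const.
- exact: norm_invariant.
- by move=> i; apply: reynolds_invariant.
have /reynolds_id <-: is_invariant (v * u * h0).
  by rewrite -Euv; apply: invariantM => //; apply: norm_invariant.
rewrite -mulrA Eu mulr_sumr reynolds_sum; apply: eq_bigr => i _.
by rewrite mulrA [v * s i * _]mulrC (reynoldsM _ (Ih i)) [RHS]mulrC.
Qed.

(** Induction on the number of vectors.  Some entry of F 0 is not in the ideal, so
    Chevalley's lemma gives u h_0 as a combination of the other h_i, which
    eliminates h_0 and leaves the vectors u F_i + s_i F_0.  Modulo the ideal these
    are u(0) F_i + s_i(0) F_0, still free as u(0) is not zero. *)
Lemma free_over_invariants m r (F : 'I_r -> 'rV[S]_m) :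
    (forall c : 'I_r -> C,
      (forall j, hilbert_ideal (\sum_i c i *: F i 0 j)) -> forall i, c i = 0) ->
  forall h : 'I_r -> S, (forall i, is_invariant (h i)) ->
    (forall j, \sum_i h i * F i 0 j = 0) -> forall i, h i = 0.
Proof.
elim: r F => [|r IHr] F freeF h Ih rel; first by case.
have [j0 nI]: exists j, ~ hilbert_ideal (F ord0 0 j).
  apply: not_all_ex_not => IF.
  suff: (ord0 == ord0 :> 'I_r.+1)%:R = 0 :> C by move/eqP; rewrite oner_eq0.
  apply: (freeF (fun i => (i == ord0)%:R)) => j.
  rewrite (bigD1 ord0) //= scale1r big1 ?addr0 // => i /negPf->.
  by rewrite scale0r.
have rel0 j: \sum_(i < r) h (lift ord0 i) * F (lift ord0 i) 0 j + h ord0 * F ord0 0 j = 0.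
  by rewrite addrC -[RHS](rel j) big_ord_recl.
have [u [s [nzu Iu Is Eu]]] :=
  chevalley_invariant (fun i => Ih (lift ord0 i)) (Ih ord0) (rel0 j0) nI.
pose F' i := u *: F (lift ord0 i) + s i *: F ord0.
have h0' i: h (lift ord0 i) = 0.
  apply: (IHr F' _ (fun i => h (lift ord0 i)) _ _ i) => [c Ic|k|j]; last first.
  - rewrite -[RHS](mulr0 u) -[in RHS](rel0 j) [RHS]mulrDr [u * (h ord0 * _)]mulrA Eu.
    rewrite mulr_suml mulr_sumr -big_split /=.
    by apply: eq_bigr => k _; rewrite !mxE mulrDr mulrCA; congr (_ + _); rewrite mulrCA mulrA.
  - exact: Ih.
  pose c' i := if unlift ord0 i is Some k then c k * u@_0%MM
               else \sum_k c k * (s k)@_0%MM.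
  have c'0: forall i, c' i = 0.
    apply: freeF => j; rewrite big_ord_recl /c' unlift_none.
    rewrite (eq_bigr (fun k => (c k * u@_0%MM) *: F (lift ord0 k) 0 j)); last first.
      by move=> k _; rewrite liftK.
    rewrite scaler_suml -big_split /=.
    pose w k : S := (u - (u@_0%MM)%:MP) * F (lift ord0 k) 0 j +
                    (s k - ((s k)@_0%MM)%:MP) * F ord0 0 j.
    suff ->: \sum_(k < r) ((c k * (s k)@_0%MM) *: F ord0 0 j +
        (c k * u@_0%MM) *: F (lift ord0 k) 0 j) =
        \sum_k c k *: F' k 0 j - \sum_k c k *: w k.
      apply: hilbert_idealD => //; apply/hilbert_idealN/hilbert_ideal_sum => k _.
      apply: hilbert_idealZ; apply: hilbert_idealD; apply: hilbert_ideal_gen.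
      - by apply: invariantD => //; apply/invariantN/invariantC.
      - by rewrite mcoeffB mcoeffC eqxx mulr1 subrr.
      - by apply: invariantD => //; apply/invariantN/invariantC.
      - by rewrite mcoeffB mcoeffC eqxx mulr1 subrr.
    rewrite -sumrB; apply: eq_bigr => k _; rewrite -!scalerA -scalerDr -scalerBr.
    congr (_ *: _); rewrite !mxE /w !mulrBl !mul_mpolyC.
    by rewrite [X in _ - X]addrACA -opprD opprB [RHS]addrC subrK [RHS]addrC.
  move=> k; have := c'0 (lift ord0 k); rewrite /c' liftK => /eqP.
  by rewrite mulf_eq0 (negPf nzu) orbF => /eqP.
move=> i; case: (unliftP ord0 i) => [k|] -> //.
apply/eqP; have nzU: u != 0 by apply: contraNneq nzu => ->; rewrite mcoeff0.
move: Eu; rewrite big1 => [/eqP|k _]; last by rewrite h0' mulr0.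
by rewrite mulf_eq0 (negPf nzU).
Qed.

End Reflections.

(** * Covariants *)

Section Covariants.
Variables (C : numClosedFieldType) (gT : finGroupType) (G : {group gT}) (n : nat).
Variable rV : mx_representation C G n.
Local Notation S := {mpoly C[n]}.
Local Notation gact := (gact rV).
Local Notation is_invariant := (is_invariant rV).
Implicit Types f u : S.

Hypothesis faithG : mx_faithful rV.

Lemma gact_distinct g h : g \in G -> h \in G -> g != h ->
  exists u, gact g u != gact h u.
Proof.
move=> Gg Gh ne_gh; apply: NNPP => same; case/eqP: ne_gh; apply: invg_inj.
apply: (mx_faithful_inj faithG); rewrite ?groupV //; apply/matrixP=> i j.
have /(congr1 (mcoeff U_(j)%MM)): gact g 'X_i = gact h 'X_i.
  by apply/eqP/negPn/negP => ne; apply: same; exists 'X_i.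
rewrite !/gact !lsubstX !raddf_sum /=.
rewrite (bigD1 j) // [X in _ = X -> _](bigD1 j) //=.
rewrite !mcoeffZ mcoeffXU eqxx !mulr1 !big1 ?addr0 // => k ne_kj.
all: by rewrite mcoeffZ mcoeffXU (negPf ne_kj) mulr0.
Qed.

(** Artin's argument: comparing the relation at u t with the relation at t
    multiplied by y u gives a relation without y, in which the coefficient of x
    is multiplied by x u - y u. *)
Lemma dedekind_independence (c : gT -> S) :
    (forall t, \sum_(g in G) c g * gact g t = 0) ->
  forall g, g \in G -> c g = 0.
Proof.
suff indep N (A : {set gT}) (c' : gT -> S): (#|A| <= N)%N -> A \subset G ->
    (forall t, \sum_(g in A) c' g * gact g t = 0) -> forall g, g \in A -> c' g = 0.
  exact: (indep #|G| G c).
elim: N => [|N IHN] in A c' * => [|leA sAG rel g Ag].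
  by rewrite leqn0 cards_eq0 => /eqP -> _ _ g; rewrite inE.
have c0 x y: x \in A -> y \in A -> x != y -> c' x = 0.
  move=> Ax Ay ne_xy.
  have [u ne_u] := gact_distinct (subsetP sAG x Ax) (subsetP sAG y Ay) ne_xy.
  have: c' x * (gact x u - gact y u) = 0.
    apply: (IHN (A :\ y) (fun z => c' z * (gact z u - gact y u))) => [||t|].
    - by move: leA; rewrite (cardsD1 y) Ay.
    - exact: subset_trans (subD1set _ _) sAG.
    - rewrite -[RHS](subrr (0 : S)) -[X in _ = X - _](rel (u * t)).
      rewrite -[X in _ = _ - X](mulr0 (gact y u)) -[X in _ = _ - _ * X](rel t).
      rewrite mulr_sumr -sumrB [RHS](bigD1 y) //= rmorphM /= mulrCA subrr add0r.
      apply: eq_big => [z|z _]; first by rewrite !inE andbC.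
      by rewrite rmorphM /= mulrBr mulrBl !mulrA [gact y u * _]mulrC.
    - by rewrite !inE ne_xy.
  by move/eqP; rewrite mulf_eq0 subr_eq0 (negPf ne_u) orbF => /eqP.
have := rel 1; rewrite (bigD1 g) //= rmorph1 mulr1 big1 ?addr0 // => x.
by case/andP=> Ax ne_xg; rewrite (c0 x g) ?mul0r.
Qed.

Hypothesis reflG : generated_by_reflections rV.
Variables (m : nat) (rL : mx_representation C G m).

(** The diagonal action on S(V^* ) (x) L, with elements written as rows so that
    changes of basis are matrix products on the left. *)
Definition twist g (v : 'rV[S]_m) : 'rV[S]_m :=
  map_mx (gact g) v *m (map_mx (@mpolyC n C) (rL g))^T.

Definition covariant v := forall g, g \in G -> twist g v = v.

Lemma map_gact_polyC g (A : 'M[C]_m) :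
  map_mx (gact g) (map_mx (@mpolyC n C) A)^T = (map_mx (@mpolyC n C) A)^T.
Proof. by apply/matrixP=> i j; rewrite !mxE gactC. Qed.

Lemma twistM g h v : g \in G -> h \in G -> twist (g * h)%g v = twist g (twist h v).
Proof.
move=> Gg Gh; have EL: (map_mx (@mpolyC n C) (rL h))^T *m (map_mx (@mpolyC n C) (rL g))^T
    = (map_mx (@mpolyC n C) (rL (g * h)%g))^T.
  by rewrite (repr_mxM rL Gg Gh) map_mxM trmx_mul.
have Ev: map_mx (gact (g * h)%g) v = map_mx (gact g) (map_mx (gact h) v).
  by apply/matrixP=> i j; rewrite !mxE gactM.
by rewrite /twist map_mxM map_gact_polyC -mulmxA EL Ev.
Qed.

Lemma twistD g v w : twist g (v + w) = twist g v + twist g w.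
Proof. by rewrite /twist map_mxD mulmxDl. Qed.

Lemma twist0 g : twist g 0 = 0.
Proof. by rewrite /twist map_mx0 mul0mx. Qed.

Lemma twistZ g u v : twist g (u *: v) = gact g u *: twist g v.
Proof. by rewrite /twist map_mxZ scalemxAl. Qed.

Lemma twist_sum g I (r : seq I) (P : pred I) F :
  twist g (\sum_(i <- r | P i) F i) = \sum_(i <- r | P i) twist g (F i).
Proof. exact: (big_morph _ (twistD g) (twist0 g)). Qed.

Lemma twist_pihomog g d v :
  twist g (map_mx (pihomog mdeg d) v) = map_mx (pihomog mdeg d) (twist g v).
Proof.
apply/rowP=> j; rewrite !mxE (raddf_sum (pihomog mdeg d)); apply: eq_bigr => i _.
rewrite !mxE [LHS]mulrC [in RHS]mulrC !mul_mpolyC.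
rewrite /gact -pihomog_lsubst; apply/mpolyP => a.
by rewrite mcoeffZ !mcoeff_pihomog mcoeffZ; case: ifP => _; rewrite ?mulr0.
Qed.

Lemma twist_transfer_covariant v : covariant (\sum_(g in G) twist g v).
Proof.
move=> g Gg; rewrite twist_sum [RHS](reindex_inj (mulgI g)) /=.
under [RHS]eq_bigl do rewrite groupMl //.
by apply: eq_bigr => h Gh; rewrite twistM.
Qed.

Definition ffun_row (F : {ffun 'I_m -> S}) : 'rV[S]_m := \row_j F j.

Lemma ffun_rowK (v : 'rV[S]_m) : ffun_row [ffun j => v 0 j] = v.
Proof. by apply/rowP=> j; rewrite mxE ffunE. Qed.

Lemma tensor_act_twist g F : ffun_row (tensor_act rV rL g F) = twist g (ffun_row F).
Proof.
apply/rowP=> j; rewrite !mxE ffunE; apply: eq_bigr => i _.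
by rewrite !mxE mulrC mul_mpolyC poly_actE.
Qed.

Lemma harmonic_invariantE F : harmonic_invariant rV rL F <->
  (forall i, harmonic rV (F i)) /\ covariant (ffun_row F).
Proof.
split=> -[harmF invF]; split=> // g Gg; first by rewrite -tensor_act_twist invF.
apply/ffunP=> j; have /rowP/(_ j) := invF g Gg.
by rewrite -tensor_act_twist !mxE.
Qed.

Definition family_mx k (b : 'I_k -> {ffun 'I_m -> S}) : 'M[S]_(k, m) :=
  \matrix_(i, j) b i j.

Lemma row_family_mx k (b : 'I_k -> {ffun 'I_m -> S}) i :
  row i (family_mx b) = ffun_row (b i).
Proof. by apply/rowP=> j; rewrite !mxE. Qed.

(** Harmonic vectors that are free over C are free modulo the ideal, hence over the
    invariants.  Given a relation with coefficients s_i in S, the transfers of the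
    t s_i are invariant coefficients of another one, for every t; they vanish, and
    Dedekind independence gives s = 0. *)
Lemma harmonic_free_domain r (b : 'I_r -> {ffun 'I_m -> S}) (s : 'rV[S]_r) :
    (forall i, harmonic_invariant rV rL (b i)) -> free_family b ->
    s *m family_mx b = 0 -> s = 0.
Proof.
move=> Wb freeb sb0.
have freeI (h : 'I_r -> S): (forall i, is_invariant (h i)) ->
    \row_i h i *m family_mx b = 0 -> forall i, h i = 0.
  move=> Ih rel; apply: (free_over_invariants reflG (F := fun i => ffun_row (b i))) => //.
    move=> c Ic; apply: freeb; apply/ffunP=> j; rewrite sum_ffunE ffunE.
    under eq_bigr do rewrite ffunE.
    apply: (harmonic_ideal0 (rV := rV)).
      by apply: harmonic_sum => i _; apply: harmonicZ; case: (Wb i).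
    have <-: \sum_i c i *: ffun_row (b i) 0 j = \sum_i c i *: b i j.
      by apply: eq_bigr => i _; rewrite mxE.
    exact: Ic.
  move=> j; move/rowP/(_ j): rel; rewrite !mxE => rel; rewrite -[RHS]rel.
  by apply: eq_bigr => i _; rewrite !mxE.
apply/rowP=> i; rewrite mxE.
rewrite -(gact1 rV (s 0 i)); apply: (dedekind_independence (c := fun g => gact g (s 0 i)));
  last exact: group1.
move=> t; rewrite (eq_bigr (fun g => gact g (t * s 0 i))); last first.
  by move=> g _; rewrite rmorphM /= mulrC.
apply: (freeI (fun i => transfer rV (t * s 0 i))) => [k|]; first exact: transfer_invariant.
have ->: (\row_k transfer rV (t * s 0 k)) = \sum_(g in G) map_mx (gact g) (t *: s).
  by apply/rowP=> k; rewrite summxE mxE; apply: eq_bigr => g _; rewrite !mxE.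
rewrite mulmx_suml big1 // => g Gg.
have twist_b: map_mx (gact g) (family_mx b) *m (map_mx (@mpolyC n C) (rL g))^T = family_mx b.
  apply/row_matrixP=> k; rewrite row_mul -map_row row_family_mx.
  by have /harmonic_invariantE[_ /(_ g Gg)] := Wb k.
by rewrite -{1}twist_b mulmxA -map_mxM -scalemxAl sb0 scaler0 map_mx0 mul0mx.
Qed.

(** The covariants have full rank m: if c is orthogonal to the transfers of all
    t (x) x_i, then it gives a relation between the automorphisms g. *)
Lemma covariants_separate (c : 'cV[S]_m) :
  (forall v, covariant v -> v *m c = 0) -> c = 0.
Proof.
move=> c0; apply/colP=> i; rewrite [in RHS]mxE.
pose d g := ((map_mx (@mpolyC n C) (rL g))^T *m c) i 0.
have <-: d 1%g = c i 0 by rewrite /d repr_mx1 map_mx1 trmx1 mul1mx.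
apply: (dedekind_independence (c := d)); last exact: group1.
move=> t; have /matrixP/(_ 0 0) := c0 _ (twist_transfer_covariant (t *: delta_mx 0 i)).
rewrite mulmx_suml summxE mxE => E; rewrite -[RHS]E; apply: eq_bigr => g _.
rewrite twistZ -scalemxAl mxE mulrC /twist -mulmxA.
have ->: map_mx (gact g) (delta_mx 0 i) = delta_mx 0 i :> 'rV[S]_m.
  by apply/matrixP=> x y; rewrite !mxE rmorph_nat.
by rewrite -rowE mxE.
Qed.

(** Averaging an expression of v with invariant coefficients averages only its
    harmonic vectors, which remain harmonic. *)
Lemma covariant_harmonic_span v : covariant v ->
  lspan is_invariant (fun p : 'rV[S]_m => (forall j, harmonic rV (p 0 j)) /\ covariant p) v.
Proof.
have harm_span: lspan is_invariant (fun p : 'rV[S]_m => forall j, harmonic rV (p 0 j)) v.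
  rewrite (row_sum_delta v); apply: lspan_sum => j _.
  elim: (harmonics_generate rV (v 0 j)) => [|a x y Ia harm_x _ IHy].
    by rewrite scale0r; apply: lspan0.
  rewrite scalerDl; set e := delta_mx 0 j in IHy *.
  have ->: (a *: x : S) *: e = a *: ((x : S) *: e) by rewrite scalerA.
  apply: lspanD => // k.
  rewrite !mxE eqxx /=; case: (k == j); rewrite ?mulr1 ?mulr0 //.
  exact: harmonic0.
pose avg w : 'rV[S]_m := (#|G|%:R^-1)%:MP *: \sum_(g in G) twist g w.
move=> cov_v; have <-: avg v = v.
  rewrite /avg (eq_bigr (fun _ => v)) // sumr_const -scaler_nat scalerA.
  rewrite -(rmorph_nat (@mpolyC n C)) -mpolyCM mulVf ?mpolyC1 ?scale1r //.
  by rewrite pnatr_eq0 -lt0n cardG_gt0.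
elim: harm_span => [|a x y Ia harm_x _ IHy].
  by rewrite /avg big1 ?scaler0 => [|g _]; [apply: lspan0 | apply: twist0].
have ->: avg (a *: x + y) = a *: avg x + avg y.
  rewrite /avg; set c := _%:MP.
  rewrite [a *: (c *: _)]scalerA [a * c]mulrC -[(c * a) *: _]scalerA -scalerDr.
  congr (_ *: _); rewrite scaler_sumr -big_split /=.
  by apply: eq_bigr => g Gg; rewrite twistD twistZ Ia.
apply: lspanD => //; split=> [j|g Gg]; last first.
  by rewrite twistZ gactC twist_transfer_covariant.
rewrite mxE mul_mpolyC summxE; apply: harmonicZ; apply: harmonic_sum => g Gg.
rewrite mxE; apply: harmonic_sum => k _; rewrite !mxE mulrC mul_mpolyC.
by apply: harmonicZ; apply: harmonic_act.
Qed.

Lemma harmonic_basis_generates k (b : 'I_k -> {ffun 'I_m -> S}) v :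
    is_basis (harmonic_invariant rV rL) b -> covariant v ->
  exists2 h : 'rV[S]_k, forall i, is_invariant (h 0 i) & v = h *m family_mx b.
Proof.
move=> [Wb freeb spanb] /covariant_harmonic_span.
elim=> [|a x y Ia [harm_x cov_x] _ [h Ih ->]].
  by exists 0; rewrite ?mul0mx // => i; rewrite mxE; apply: invariant0.
have [|c Ec] := spanb [ffun j => x 0 j].
  by apply/harmonic_invariantE; rewrite ffun_rowK; split=> // i; rewrite ffunE.
exists (a *: \row_i (c i)%:MP + h) => [i|].
  rewrite !mxE; apply: invariantD => //; apply: invariantM => //; exact: invariantC.
rewrite mulmxDl -scalemxAl; congr (_ *: _ + _); apply/rowP=> j.
have /ffunP/(_ j) := Ec; rewrite ffunE sum_ffunE mxE => ->.
by apply: eq_bigr => i _; rewrite ffunE !mxE mul_mpolyC.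
Qed.

Lemma harmonic_free_leq r (b : 'I_r -> {ffun 'I_m -> S}) :
  (forall i, harmonic_invariant rV rL (b i)) -> free_family b -> (r <= m)%N.
Proof.
move=> Wb freeb; rewrite leqNgt; apply/negP => /(mx_left_kernel (family_mx b))[s nzs sb].
by case/eqP: nzs; apply: harmonic_free_domain sb.
Qed.

Lemma harmonic_basis_dim k (b : 'I_k -> {ffun 'I_m -> S}) :
  is_basis (harmonic_invariant rV rL) b -> k = m.
Proof.
move=> basb; have [Wb freeb _] := basb; apply/eqP.
rewrite eqn_leq (harmonic_free_leq Wb freeb) leqNgt; apply/negP => /=.
case/(mx_left_kernel (family_mx b)^T) => s nzs sb; case/eqP: nzs; apply: trmx_inj.
rewrite trmx0; apply: covariants_separate => v /(harmonic_basis_generates basb)[h _ ->].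
by rewrite -mulmxA -[family_mx b]trmxK -trmx_mul sb trmx0 mulmx0.
Qed.

Lemma harmonic_basis_det (b : 'I_m -> {ffun 'I_m -> S}) :
  is_basis (harmonic_invariant rV rL) b -> \det (family_mx b) != 0.
Proof.
move=> [Wb freeb _]; apply/det0P => -[s nzs sb].
by case/eqP: nzs; apply: harmonic_free_domain sb.
Qed.

(** Homogeneous components of harmonic covariants are harmonic covariants, so a
    maximal free family of homogeneous ones is a basis. *)
Lemma homogeneous_harmonic_basis : exists (e : 'I_m -> nat) b,
  is_basis (harmonic_invariant rV rL) b /\ forall i j, b i j \is (e i).-homog.
Proof.
have [|r [b [Pb freeb spanb]]] := @max_free_family C {ffun 'I_m -> S}
    (fun F => harmonic_invariant rV rL F /\ exists d, forall j, F j \is d.-homog) m.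
  by move=> r b Pb; apply: harmonic_free_leq => i; case: (Pb i).
have basb: is_basis (harmonic_invariant rV rL) b.
  split=> // [i|F WF]; first by case: (Pb i).
  pose k := (\max_j msize (F j))%N.
  pose Fd d : {ffun 'I_m -> S} := [ffun j => pihomog mdeg d (F j)].
  have EF: F = \sum_(d < k) Fd d.
    apply/ffunP=> j; rewrite sum_ffunE; under eq_bigr do rewrite ffunE.
    by apply: pihomog_partitionE; exact: (@leq_bigmax _ (fun j => msize (F j)) j).
  have /harmonic_invariantE[harmF covF] := WF.
  have /fin_all_exists[c Ec]: forall d : 'I_k, exists c : 'I_r -> C, Fd d = \sum_i c i *: b i.
    move=> d; apply: spanb; split; last by exists d => j; rewrite ffunE; apply: pihomogP.
    apply/harmonic_invariantE; split=> [j|g Gg].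
      by rewrite ffunE; apply: harmonic_pihomog.
    have ->: ffun_row (Fd d) = map_mx (pihomog mdeg d) (ffun_row F).
      by apply/rowP=> j; rewrite !mxE ffunE.
    by rewrite twist_pihomog covF.
  exists (fun i => \sum_(d < k) c d i); rewrite EF (eq_bigr _ (fun d _ => Ec d)).
  by rewrite exchange_big; apply: eq_bigr => i _; rewrite scaler_suml.
have Erm := harmonic_basis_dim basb; subst r.
have /fin_all_exists[e homb] := fun i => (Pb i).2.
by exists e, b.
Qed.

End Covariants.

(** * Determinants of bases of covariants *)

Section Amenability.
Variable C : numClosedFieldType.

Lemma msize_mul_geq n (f h : {mpoly C[n]}) : h * f != 0 -> (msize f <= msize (h * f))%N.
Proof.
rewrite mulf_eq0 negb_or => /andP[nzh nzf].
by rewrite msizeM // (mpolySpred _ nzh) addSn leq_addl.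
Qed.

Lemma msize_mulmx_geq n m (A H : 'M[{mpoly C[n]}]_m) :
  \det (H *m A) != 0 -> (msize (\det A) <= msize (\det (H *m A)))%N.
Proof. by rewrite det_mulmx; apply: msize_mul_geq. Qed.

Lemma mulmx_by_rows (R : pzRingType) p q r (X : 'M[R]_(p, r)) (Y : 'M[R]_(q, r)) :
  (forall i, exists h, row i X = h *m Y) -> exists H, X = H *m Y.
Proof.
move=> /fin_all_exists[h Eh]; exists (\matrix_i h i).
by apply/row_matrixP=> i; rewrite row_mul rowK Eh.
Qed.

Lemma det_homog n m (A : 'M[{mpoly C[n]}]_m) (e : 'I_m -> nat) :
  (forall i j, A i j \is (e i).-homog) -> \det A \is (\sum_i e i)%N.-homog.
Proof.
move=> homA; apply: rpred_sum => s _; rewrite rpredMsign.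
pose K (h : {mpoly C[n]}) d := is_true (h \is d.-homog).
apply: (big_rec2 K) => [|i h d _ homh]; first exact: dhomog1.
by apply: dhomogM.
Qed.

Section Group.
Variables (gT : finGroupType) (G : {group gT}) (n : nat).
Variable rV : mx_representation C G n.
Hypotheses (faithG : mx_faithful rV) (reflG : generated_by_reflections rV).
Local Notation S := {mpoly C[n]}.

Section Module.
Variables (m : nat) (rL : mx_representation C G m).

(** In other words, f (x) x_1 /\ ... /\ x_m is invariant in
    S(V^* ) (x) Lambda^m L. *)
Definition det_covariant (f : S) :=
  forall g, g \in G -> gact rV g f * (\det (rL g))%:MP = f.

Lemma det_covariants (A : 'M[S]_m) :
  (forall i, covariant rV rL (row i A)) -> det_covariant (\det A).
Proof.
move=> covA g Gg.
have {2}<-: map_mx (gact rV g) A *m (map_mx (@mpolyC n C) (rL g))^T = A.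
  by apply/row_matrixP=> i; rewrite row_mul -map_row; apply: covA.
by rewrite det_mulmx (det_tr (map_mx _ _)) !det_map_mx.
Qed.

End Module.

Lemma exponents_exist m (rM : mx_representation C G m) : exists e, exponents rV rM e.
Proof.
have [e [b [basb homb]]] := homogeneous_harmonic_basis faithG reflG (dual_repr rM).
by exists e, b.
Qed.

Lemma exponents_family m (rM : mx_representation C G m) e : exponents rV rM e ->
  exists A : 'M[S]_m, [/\ \det A != 0, msize (\det A) = (\sum_i e i).+1,
    forall i, covariant rV (dual_repr rM) (row i A)
  & forall v, covariant rV (dual_repr rM) v ->
      exists2 h : 'rV[S]_m, forall i, is_invariant rV (h 0 i) & v = h *m A].
Proof.
case=> b [basb homb]; exists (family_mx b).
have nzd := harmonic_basis_det faithG reflG basb; split=> //.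
- by apply: msize_homog => //; apply: det_homog => i j; rewrite mxE.
- by move=> i; rewrite row_family_mx; case: basb => /(_ i)/harmonic_invariantE[].
- by move=> v; apply: harmonic_basis_generates.
Qed.

(** The case of a module of dimension one, where the exponent is the degree of a
    generator of the module of covariants. *)
Lemma top_exponent_generator m (rM : mx_representation C G m) d :
    exponents rV (topext_repr rM) d ->
  exists p : S, [/\ p != 0, msize p = (d ord0).+1, det_covariant (dual_repr rM) p
  & forall f, det_covariant (dual_repr rM) f -> exists2 h, is_invariant rV h & f = h * p].
Proof.
case/exponents_family=> A [nzA szA covA genA].
have covE v : covariant rV (dual_repr (topext_repr rM)) v <->
    det_covariant (dual_repr rM) (v 0 0).
  have Etw g: twist rV (dual_repr (topext_repr rM)) g v 0 0 =
      gact rV g (v 0 0) * (\det (dual_repr rM g))%:MP.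
    by rewrite !mxE big_ord1 !mxE eqxx mulr1n det_tr.
  split=> covv g Gg; first by rewrite -Etw covv.
  by apply/rowP=> j; rewrite !ord1 Etw covv.
exists (A 0 0); rewrite -det_mx11; split=> //; first by rewrite szA big_ord1.
  by rewrite det_mx11; have /covE := covA 0; rewrite mxE.
move=> f covf; have [|h Ih /rowP/(_ 0)] := genA (const_mx f).
  by apply/covE; rewrite mxE.
by rewrite !mxE big_ord1 => ->; exists (h 0 0) => //; rewrite det_mx11.
Qed.

End Group.
End Amenability.

(** * Passing to a normal reflection subgroup *)

Section NormalReflectionSubgroup.
Variables (C : numClosedFieldType) (gT : finGroupType) (G N : {group gT}) (n : nat).
Variable rV : mx_representation C G n.
Hypotheses (faithG : mx_faithful rV) (reflG : generated_by_reflections rV).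
Variable sNG : N \subset G.
Local Notation rVN := (subg_repr rV sNG).
Hypothesis reflN : generated_by_reflections rVN.
Local Notation S := {mpoly C[n]}.
Variables (m : nat) (rM : mx_representation C G m).
Local Notation rMN := (subg_repr rM sNG).

Let faithN : mx_faithful rVN := subg_mx_faithful sNG faithG.

Section Bases.
Variables (rU rW : mx_representation C G m) (b : 'I_m -> {ffun 'I_m -> S}).
Hypotheses (basb : is_basis (harmonic_invariant rVN (dual_repr rMN)) b)
  (actb : forall g, g \in G -> forall j,
     tensor_act rV (dual_repr rM) g (b j) = \sum_i rW g i j *: b i)
  (dualU : forall g, g \in G -> rU g = dual_repr rW g).
Let B := family_mx b.

Lemma dual_rU g : g \in G -> dual_repr rU g = rW g.
Proof. by move=> Gg; rewrite /= /dual_mx dualU ?groupV //= /dual_mx invgK trmxK. Qed.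

(** G permutes the N-covariants, acting on the span of b by the dual of U. *)
Lemma twist_basis g : g \in G ->
  map_mx (gact rV g) B *m (map_mx (@mpolyC n C) (dual_repr rM g))^T =
  (map_mx (@mpolyC n C) (dual_repr rU g))^T *m B.
Proof.
move=> Gg; apply/row_matrixP=> j; rewrite row_mul -map_row row_family_mx.
rewrite -/(twist rV (dual_repr rM) g _) -tensor_act_twist actb // dual_rU //.
apply/rowP=> k; rewrite !mxE sum_ffunE; apply: eq_bigr => i _.
by rewrite !ffunE !mxE mul_mpolyC.
Qed.

Lemma twist_mul_basis g (s : 'rV[S]_m) : g \in G ->
  twist rV (dual_repr rM) g (s *m B) = twist rV (dual_repr rU) g s *m B.
Proof. by move=> Gg; rewrite /twist map_mxM -mulmxA twist_basis // mulmxA. Qed.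

Lemma det_act_basis g : g \in G ->
  gact rV g (\det B) * (\det (dual_repr rM g))%:MP =
  (\det (dual_repr rU g))%:MP * \det B.
Proof.
move=> Gg; have := congr1 determinant (twist_basis Gg).
by rewrite !det_mulmx !(det_tr (map_mx _ _)) !det_map_mx.
Qed.

Lemma det_basis_neq0 : \det B != 0.
Proof. exact: (harmonic_basis_det faithN reflN basb). Qed.

Lemma covariant_subg (v : 'rV[S]_m) :
  covariant rV (dual_repr rM) v -> covariant rVN (dual_repr rMN) v.
Proof. by move=> covv g Ng; apply: covv; apply: (subsetP sNG). Qed.

(** Every G-covariant of M is v = s B for a unique row s over S(V^* ); by
    uniqueness s is itself a G-covariant, of the dual of U. *)
Lemma covariant_factor (v : 'rV[S]_m) : covariant rV (dual_repr rM) v ->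
  exists2 s, covariant rV (dual_repr rU) s & v = s *m B.
Proof.
move=> covv; have [s _ Ev] :=
  harmonic_basis_generates basb (covariant_subg covv).
exists s => // g Gg; apply/eqP; rewrite -subr_eq0; apply/eqP.
apply: contra_not_eq (negP det_basis_neq0) => nz; apply/det0P.
exists (twist rV (dual_repr rU) g s - s) => //.
by rewrite mulmxBl -twist_mul_basis // -/B -Ev covv // subrr.
Qed.

(** A and F *m B generate the same module of covariants, so each determinant is a
    multiple of the other. *)
Lemma msize_det_factor (A F : 'M[S]_m) :
    \det A != 0 -> (forall i, covariant rV (dual_repr rM) (row i A)) ->
    (forall v, covariant rV (dual_repr rM) v -> exists2 h : 'rV[S]_m,
       forall i, is_invariant rV (h 0 i) & v = h *m A) ->
    \det F != 0 -> (forall i, covariant rV (dual_repr rU) (row i F)) ->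
    (forall v, covariant rV (dual_repr rU) v -> exists2 h : 'rV[S]_m,
       forall i, is_invariant rV (h 0 i) & v = h *m F) ->
  msize (\det A) = msize (\det F * \det B).
Proof.
move=> nzA covA genA nzF covF genF; rewrite -det_mulmx.
have [H EA]: exists H, A = H *m (F *m B).
  apply: mulmx_by_rows => i; have [s /genF[h _ ->] ->] := covariant_factor (covA i).
  by exists h; rewrite mulmxA.
have [K EF]: exists K, F *m B = K *m A.
  apply: mulmx_by_rows => i; have [|h _ ->] := genA (row i (F *m B)); last by exists h.
  by rewrite row_mul => g Gg; rewrite twist_mul_basis // covF.
apply/eqP; rewrite eqn_leq {1}EF {3}EA !msize_mulmx_geq // -?EA -?EF //.
by rewrite det_mulmx mulf_neq0 ?det_basis_neq0.
Qed.

(** q \det B is a determinantal covariant of M, hence a multiple of p, which has the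
    degree of \det F \det B when M is amenable; so q has at least the degree of
    \det F. *)
Lemma amenable_up : amenable rV rM -> amenable rV rU.
Proof.
case=> e [d [/(exponents_family faithG reflG)[A [nzA szA covA genA]]
  /(top_exponent_generator faithG reflG)[p [nzp szp covp genp]] Eed]].
have [e' expU] := exponents_exist faithG reflG rU.
have [d' topU] := exponents_exist faithG reflG (topext_repr rU).
exists e', d'; split=> //; apply: succn_inj.
have [F [nzF <- covF genF]] := exponents_family faithG reflG expU.
have [q [nzq <- covq genq]] := top_exponent_generator faithG reflG topU.
have nzB := det_basis_neq0.
have szAFB := msize_det_factor nzA covA genA nzF covF genF.
have le_qF: (msize q <= msize (\det F))%N.
  have [h _ EF] := genq _ (det_covariants covF).
  by rewrite EF msize_mul_geq // -EF.
have le_pqB: (msize p <= msize (q * \det B))%N.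
  have [|h _ E] := genp (q * \det B).
    move=> g Gg; rewrite rmorphM /= -mulrA det_act_basis // mulrA.
    by rewrite covq.
  by rewrite E msize_mul_geq // -E mulf_neq0.
apply/eqP; rewrite eqn_leq le_qF andbT.
move: le_pqB; rewrite szp -Eed -szA szAFB !msizeM //.
by rewrite (mpolySpred _ nzB) !addnS /= leq_add2r.
Qed.

(** Amenability for N makes \det B divide p with a determinantal covariant r of U as
    quotient; q divides r and has the degree of \det F, so p has at least the
    degree of \det F \det B. *)
Lemma amenable_down : amenable rVN rMN -> amenable rV rU -> amenable rV rM.
Proof.
case=> eN [dN [/(exponents_family faithN reflN)[AN [nzAN szAN covAN genAN]]
  /(top_exponent_generator faithN reflN)[pN [nzpN szpN covpN genpN]] EN]].
case=> e' [d' [/(exponents_family faithG reflG)[F [nzF szF covF genF]]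
  /(top_exponent_generator faithG reflG)[q [nzq szq covq genq]] EU]].
have [e expM] := exponents_exist faithG reflG rM.
have [d topM] := exponents_exist faithG reflG (topext_repr rM).
exists e, d; split=> //; apply: succn_inj.
have [A [nzA <- covA genA]] := exponents_family faithG reflG expM.
have [p [nzp <- covp genp]] := top_exponent_generator faithG reflG topM.
have nzB := det_basis_neq0.
have szAFB := msize_det_factor nzA covA genA nzF covF genF.
have covB i : covariant rVN (dual_repr rMN) (row i B).
  by rewrite row_family_mx; case: basb => /(_ i)/harmonic_invariantE[].
(* Any two bases of the N-covariants have determinants of the same degree, which
   is that of pN by amenability for N; so pN divides \det B up to a constant. *)
have [c nzc Ec]: exists2 c : C, c != 0 & \det B = c *: pN.
  have [h _ EB] := genpN _ (det_covariants covB).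
  have nzh: h != 0 by apply: contraNneq nzB => h0; rewrite EB h0 mul0r.
  have szB: (msize (\det B) <= msize pN)%N.
    rewrite szpN -EN -szAN; have [K EK]: exists K, AN = K *m B.
      apply: mulmx_by_rows => i.
      by have [h' _ Eh'] := harmonic_basis_generates basb (covAN i); exists h'.
    by rewrite EK; apply: msize_mulmx_geq; rewrite -EK.
  have le_h1: (msize h <= 1)%N.
    move: szB; rewrite EB msizeM // (mpolySpred _ nzpN) addnS /=.
    by rewrite -[X in (_ <= X)%N]add1n leq_add2r.
  have Eh := msize1_polyC le_h1; exists h@_0%MM; last by rewrite EB {1}Eh mul_mpolyC.
  by apply: contraNneq nzh => h0; rewrite Eh h0.
have le_pA: (msize p <= msize (\det A))%N.
  have [h _ EA] := genp _ (det_covariants covA).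
  by rewrite EA msize_mul_geq // -EA.
(* p is also a determinantal covariant for N, hence a multiple of \det B; the
   quotient r carries the difference of the two characters of G. *)
have [r Er]: exists r, p = r * \det B.
  have [h _ ->] := genpN p (fun g Ng => covp g (subsetP sNG g Ng)).
  exists (c^-1 *: h).
  by rewrite Ec -scalerAl -scalerAr scalerA mulVf ?scale1r.
have covr: det_covariant rV (dual_repr rU) r.
  move=> g Gg; apply: (mulIf nzB); rewrite -mulrA -det_act_basis // mulrA -rmorphM.
  by rewrite -Er covp.
have nzr: r != 0 by apply: contraNneq nzp => r0; rewrite Er r0 mul0r.
have le_qr: (msize q <= msize r)%N.
  by have [h _ Erh] := genq _ covr; rewrite Erh msize_mul_geq // -Erh.
apply/eqP; rewrite eqn_leq le_pA andbT szAFB Er !msizeM // szF EU -szq.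
by rewrite (mpolySpred _ nzB) !addnS /= leq_add2r.
Qed.

End Bases.

End NormalReflectionSubgroup.

Theorem proposition3p12 (R : realType) (gT : finGroupType) (G N : {group gT})
    (n : nat) (rV : mx_representation R[i]%C G n)
    (crG : complex_reflection_group rV)
    (nNG : (N <| G)%g)
    (reflN : generated_by_reflections (subg_repr rV (normal_sub nNG)))
    (m : nat) (rM : mx_representation R[i]%C G m)
    (k : nat) (rU : mx_representation R[i]%C G k)
    (defU : is_U rV (normal_sub nNG) rM rU) :
  (amenable rV rM -> amenable rV rU) /\
  (amenable (subg_repr rV (normal_sub nNG)) (subg_repr rM (normal_sub nNG)) ->
   amenable rV rU -> amenable rV rM).
Proof.
have [faithG reflG] := crG.
have [rW [[b [basb actb]] dualU]] := defU.
have faithN := subg_mx_faithful (normal_sub nNG) faithG.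
have Ekm := harmonic_basis_dim faithN reflN basb; subst k.
split.
  exact: (amenable_up faithG reflG reflN basb actb dualU).
exact: (amenable_down faithG reflG reflN basb actb dualU).
Qed.
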